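(* Let $m\ge 2$ be an integer, let $q=m$, let $0<\epsilon<1/q$, and let $\mathbf{T}^{MILP}$ be the task set with $n=m+4$ tasks defined in the context (with this $q$). Then the optimal value of the full MILP (defined in the context) for task $\tau_n$ in $\mathbf{T}^{MILP}$, divided by the exact worst-case response time of $\tau_n$ under fixed-priority preemptive scheduling, is at least $$\frac{m(8m^2+6m+1+m\epsilon)+(m-1)(2m-1)}{16m^2+(m-1)(2m-1)}\ \ge\ \frac{4m+4}{9}.$$
   Context: Task model. Tasks $\tau_1,\dots,\tau_n$ are indexed by decreasing priority on a uniprocessor with fixed-priority preemptive scheduling (the ready job of highest priority executes). For $i<n$, $\tau_i$ is an ordinary sporadic task: consecutive job releases are at least $T_i$ apart, each job requires at most $C_i$ units of processor time, relative deadline $D_i$. The lowest-priority task $\tau_n$ is segmented self-suspending with array $(C_n^1,S_n^1,\dots,S_n^{m-1},C_n^m)$: each job has $m$ computation segments, the $j$-th requiring at most $C_n^j$ time, and after finishing segment $j<m$ the job suspends (cannot execute) for at most $S_n^j$ time before segment $j+1$ becomes ready. Put $S_n=\sum_{j=1}^{m-1}S_n^j$. The response time of a job is its finishing time minus its release time; the (exact) worst-case response time of $\tau_n$ is the supremum of response times of its jobs over all release patterns respecting these constraints. Task set $\mathbf{T}^{MILP}$ (parameters: integers $q\ge 1$, $m\ge2$, real $0<\epsilon<1/q$), $n=m+4$: $C_1=1$, $D_1=T_1=2$; $C_2=q$, $D_2=T_2=4q$; $C_3=2q-1+\epsilon$, $D_3=T_3=8q$; for $i=4,\dots,m+3$: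 $C_i=1-\epsilon$, $D_i=8qm$, $T_i=16qm^2+(m-1)(2q-1)$; $\tau_{m+4}=\tau_n$ has $m$ computation segments, $C_n^j=1-\epsilon$ for $j=1,\dots,m$, $S_n^j=2q-1$ for $j=1,\dots,m-1$, and $T_n$ is assumed sufficiently large (depending on $q,m,\epsilon$). Full MILP. Variables: real $R_j$, real $O_{i,j}$, integer $N_{i,j}$ ($1\le i\le n-1$, $1\le j\le m$). Maximize $S_n+\sum_{j=1}^m R_j$ subject to, for all indices $i,j$ as applicable: (1) $R_j=C_n^j+\sum_{i=1}^{n-1}N_{i,j}C_i$; (2) $O_{i,j}\ge0$; (3) $O_{i,j+1}\ge O_{i,j}+N_{i,j}T_i-(R_j+S_n^j)$ for $j\le m-1$; (4) $0\le N_{i,j}\le\lceil (R_j-O_{i,j})/T_i\rceil$; (5) $R_j\le UB_{ss,j}$; (6) $S_n+\sum_{j=1}^m R_j\le UB_{ss}$; (7) $R_j>rel_{i,j}+\sum_{\ell=1}^{n-1}\max\{0,\lfloor (O_{\ell,j}+N_{\ell,j}T_\ell-rel_{i,j})/T_\ell\rfloor C_\ell\}$, where $rel_{i,j}=O_{i,j}+(N_{i,j}-1)T_i$. The optimal value means the supremum of the objective over feasible points. Upper bounds. For $W>0$ let $\rho(W)$ be the least $t>0$ with $W+\sum_{i=1}^{n-1}\lceil t/T_i\rceil C_i=t$. Then $UB_{ss,j}=\rho(C_n^j)$. $UB_{ss}$ is the bound from the ''joint and split'' methods: each suspension interval $S_n^j$ is either treated as computation (joint) or as suspension (split), so the segments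 are grouped into maximal blocks of consecutive segments connected by joint intervals; a block has workload $W$ equal to the sum of its computation segments and its joint intervals, and the resulting bound is the sum of $\rho(W)$ over all blocks plus the sum of all split intervals; $UB_{ss}$ is the minimum of this bound over all choices of joint/split. *)

(* Defs.v *)
(* MathComp / MathComp-Analysis *)
From HB Require Import structures.
From mathcomp Require Import all_boot all_order all_algebra.
From mathcomp Require Import all_classical all_reals all_analysis.
Set Implicit Arguments.
Unset Strict Implicit.
Unset Printing Implicit Defensive.
Import Order.TTheory GRing.Theory Num.Theory.
Import numFieldNormedType.Exports.
Local Open Scope classical_set_scope.
Local Open Scope ring_scope.

(* Tasks are numbered 1, ..., n by decreasing priority, the segments of task n
   1, ..., m, and its suspension intervals 1, ..., m - 1.  Values of the
   functions below at indices out of these ranges are never used.  The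
   deadlines do not influence the schedule; that of task n is unspecified. *)
Record taskset (R : realType) := TaskSet {
  ntasks : nat;
  wcet : nat -> R;       (* C_i,   1 <= i < n *)
  deadline : nat -> R;   (* D_i,   1 <= i < n *)
  period : nat -> R;     (* T_i,   1 <= i <= n *)
  nsegs : nat;           (* m *)
  seg_wcet : nat -> R;   (* C_n^j, 1 <= j <= m *)
  seg_susp : nat -> R    (* S_n^j, 1 <= j < m *)
}.

Section Scheduling.
Context {R : realType}.
Implicit Type ts : taskset R.

Definition total_susp ts : R := \sum_(1 <= j < nsegs ts) seg_susp ts j.

(* For the purpose of scheduling, an ordinary sporadic task is a segmented task
   with a single computation segment. *)
Definition task_nsegs ts (i : nat) : nat := if i == ntasks ts then nsegs ts else 1%N.

Definition task_seg_wcet ts (i j : nat) : R :=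
  if i == ntasks ts then seg_wcet ts j else wcet ts i.

(* Segment j of the k-th job (k = 0, 1, ...) of task i is (i, k, j). *)
Definition segment : Type := (nat * nat * nat)%type.

(* As actual execution times are only bounded from above, a job of execution
   time 0 plays the role of a job that is never released: infinite release
   sequences also cover finite ones. *)
Record run := Run {
  release : nat -> nat -> R;          (* task, job *)
  cost : nat -> nat -> nat -> R;      (* task, job, segment *)
  susp : nat -> nat -> nat -> R;      (* task, job, suspension interval *)
  sched : R -> option segment         (* what is executed at time t, if anything *)
}.
Implicit Type x : run.

Definition exec_set x (s : segment) : set (measurableTypeR R) :=
  [set u | sched x u = Some s].

Definition service x (s : segment) (t : R) : R :=
  fine (lebesgue_measure (exec_set x s `&` `[0, t[%classic)).

(* First instant at or after a at which segment s has received all its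
   execution time; +oo if there is none. *)
Definition finish_from x (s : segment) (a : \bar R) : \bar R :=
  ereal_inf [set t%:E | t in
    [set t : R | (a <= t%:E)%E /\ cost x s.1.1 s.1.2 s.2 <= service x s t]].

(* Segments are numbered from 1. *)
Fixpoint ready_time x (i k j : nat) : \bar R :=
  match j with
  | (_.+1 as j').+1 =>
      (finish_from x (i, k, j') (ready_time x i k j') + (susp x i k j')%:E)%E
  | _ => (release x i k)%:E
  end.

Definition finish_time x (i k j : nat) : \bar R :=
  finish_from x (i, k, j) (ready_time x i k j).

Definition ready ts x (s : segment) (t : R) : Prop :=
  let: (i, k, j) := s in
  [/\ (1 <= i <= ntasks ts)%N, (1 <= j <= task_nsegs ts i)%N,
      (ready_time x i k j <= t%:E)%E & service x s t < cost x i k j].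

(* Time starts at 0.  Nothing is assumed on the choice between ready jobs of the
   same task. *)
Record legal_run ts x : Prop := LegalRun {
  legal_start : forall i, (1 <= i <= ntasks ts)%N -> 0 <= release x i 0;
  legal_sporadic : forall i k, (1 <= i <= ntasks ts)%N ->
    release x i k + period ts i <= release x i k.+1;
  legal_cost : forall i k j,
    (1 <= i <= ntasks ts)%N -> (1 <= j <= task_nsegs ts i)%N ->
    0 <= cost x i k j <= task_seg_wcet ts i j;
  legal_susp : forall k j, (1 <= j < nsegs ts)%N ->
    0 <= susp x (ntasks ts) k j <= seg_susp ts j;
  legal_measurable : forall s, measurable (exec_set x s);
  legal_ready : forall t s, sched x t = Some s -> ready ts x s t;
  legal_priority : forall t i k j, ready ts x (i, k, j) t ->
    exists i' k' j', sched x t = Some (i', k', j') /\ (i' <= i)%N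
}.

Definition response_time ts x (k : nat) : \bar R :=
  (finish_time x (ntasks ts) k (nsegs ts) - (release x (ntasks ts) k)%:E)%E.

Definition wcrt ts : \bar R :=
  ereal_sup [set r | exists x k, legal_run ts x /\ r = response_time ts x k].

(* The least positive solution of the fixed-point equation (the infimum is
   attained for W > 0), and +oo if there is no solution. *)
Definition rho ts (W : R) : \bar R :=
  ereal_inf [set t%:E | t in [set t : R | 0 < t /\
    W + \sum_(1 <= i < ntasks ts) (Num.ceil (t / period ts i))%:~R * wcet ts i = t]].

Definition UB_seg ts (j : nat) : \bar R := rho ts (seg_wcet ts j).

(* A choice J : nat -> bool says for each suspension interval whether it is
   treated as computation (true, joint) or as suspension (false, split). *)
Definition is_block ts (J : nat -> bool) (a b : nat) : bool :=
  [&& (a == 1%N) || ~~ J a.-1,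
      (b == nsegs ts) || ~~ J b
    & all J (index_iota a b)].

Definition block_workload ts (a b : nat) : R :=
  \sum_(a <= j < b.+1) seg_wcet ts j + \sum_(a <= j < b) seg_susp ts j.

Definition joint_split_bound ts (J : nat -> bool) : \bar R :=
  (\sum_(1 <= a < (nsegs ts).+1) \sum_(a <= b < (nsegs ts).+1 | is_block ts J a b)
      rho ts (block_workload ts a b)
   + (\sum_(1 <= j < nsegs ts | ~~ J j) seg_susp ts j)%:E)%E.

(* A minimum: only the values of J at 1, ..., m - 1 matter. *)
Definition UB_ss ts : \bar R := ereal_inf (range (joint_split_bound ts)).

Record milp_point := MilpPoint {
  mR : nat -> R;           (* R_j *)
  mO : nat -> nat -> R;    (* O_{i,j} *)
  mN : nat -> nat -> int   (* N_{i,j} *)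
}.
Implicit Type p : milp_point.

Definition milp_rel ts p (i j : nat) : R :=
  mO p i j + (mN p i j - 1)%:~R * period ts i.

Definition milp_objective ts p : R :=
  total_susp ts + \sum_(1 <= j < (nsegs ts).+1) mR p j.

Record milp_feasible ts p : Prop := MilpFeasible {
  milp_R : forall j, (1 <= j <= nsegs ts)%N ->
    mR p j = seg_wcet ts j
             + \sum_(1 <= i < ntasks ts) (mN p i j)%:~R * wcet ts i;
  milp_O_ge0 : forall i j, (1 <= i < ntasks ts)%N -> (1 <= j <= nsegs ts)%N ->
    0 <= mO p i j;
  milp_O_next : forall i j, (1 <= i < ntasks ts)%N -> (1 <= j < nsegs ts)%N ->
    mO p i j.+1 >=
      mO p i j + (mN p i j)%:~R * period ts i - (mR p j + seg_susp ts j);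
  milp_N : forall i j, (1 <= i < ntasks ts)%N -> (1 <= j <= nsegs ts)%N ->
    0 <= mN p i j <= Num.ceil ((mR p j - mO p i j) / period ts i);
  milp_UB_seg : forall j, (1 <= j <= nsegs ts)%N ->
    ((mR p j)%:E <= UB_seg ts j)%E;
  milp_UB_ss : ((milp_objective ts p)%:E <= UB_ss ts)%E;
  milp_busy : forall i j, (1 <= i < ntasks ts)%N -> (1 <= j <= nsegs ts)%N ->
    mR p j > milp_rel ts p i j
      + \sum_(1 <= l < ntasks ts)
          Num.max 0
            ((Num.floor ((mO p l j + (mN p l j)%:~R * period ts l
                          - milp_rel ts p i j) / period ts l))%:~R * wcet ts l)
}.

Definition milp_opt ts : \bar R :=
  ereal_sup [set (milp_objective ts p)%:E | p in [set p | milp_feasible ts p]].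

(* The task set T^MILP; Tn is the period of the suspending task n = m + 4. *)
Definition T_MILP (q m : nat) (eps Tn : R) : taskset R := {|
  ntasks := (m + 4)%N;
  wcet := fun i => match i with
    | 1%N => 1
    | 2%N => q%:R
    | 3%N => 2 * q%:R - 1 + eps
    | _ => 1 - eps
    end;
  deadline := fun i => match i with
    | 1%N => 2
    | 2%N => 4 * q%:R
    | 3%N => 8 * q%:R
    | _ => 8 * q%:R * m%:R
    end;
  period := fun i => if i == (m + 4)%N then Tn else match i with
    | 1%N => 2
    | 2%N => 4 * q%:R
    | 3%N => 8 * q%:R
    | _ => 16 * q%:R * m%:R ^+ 2 + (m%:R - 1) * (2 * q%:R - 1)
    end;
  nsegs := m;
  seg_wcet := fun=> 1 - eps;
  seg_susp := fun=> 2 * q%:R - 1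
|}.

End Scheduling.

(* Main.v *)
Require Import Defs.
From mathcomp Require Import all_boot all_order all_algebra.
From mathcomp Require Import all_classical all_reals all_analysis.
From mathcomp Require Import zify ring lra.
Import Order.TTheory GRing.Theory Num.Theory.
Local Open Scope classical_set_scope.
Local Open Scope ring_scope.

(* MILP side. For every segment take R_j = 8m^2 + 6m + 1 + m eps, with
   4m^2 + 3m + 1, 2m + 2 and m + 1 jobs of tasks 1, 2, 3 and no job of the other
   tasks: this is a fixed point of the response-time equation of tasks 1, 2, 3,
   though not the least one. All offsets are 0, except O_{3,j} = 1, which is needed
   for constraint (7). It respects the upper bounds because tasks 1, 2, 3 leave only
   1 - eps free in each period of 8m, so that even with all the other tasks released
   at once no block of segments can end earlier.

   Response-time side. In any window of length 8m, whatever the carry-in, tasks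
   1, 2, 3 leave at least 1 - eps of processor time. Each of the m tasks
   4, ..., m + 3 runs at most one job during a job of the suspending task, and that
   job, if it runs while a segment is ready, completes before the segment does. So a
   segment delayed by n of them takes at most 8m(1 + n), and the m segments together
   at most 16m^2. *)

(** * Processor time received by a set of segments in a window, as a Lebesgue measure *)

Section Work.
Context {R : realType}.
Implicit Types (x : @run R) (P Q : pred segment) (a b c : R).

Definition executes x P : set (measurableTypeR R) :=
  [set u | if sched x u is Some s then P s else false].

Definition work x P a b : R :=
  fine (lebesgue_measure (executes x P `&` `[a, b[)%classic).

Context (x : @run R) (mx : forall s, measurable (exec_set x s)).

(** Segments are triples of naturals, so this is a countable union of sets [exec_set x s]. *)
Lemma measurable_executes P : measurable (executes x P).
Proof.
have -> : executes x P = (\bigcup_s (if P s then exec_set x s else set0))%classic.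
  apply/seteqP; split => u; rewrite /executes /exec_set /=.
    by case E : (sched x u) => [s|] // Ps; exists s => //; rewrite Ps.
  by case=> s _; case: ifP => // Ps /= ->.
apply: countable_bigcupT_measurable => [|s]; first exact: countableP.
by case: ifP.
Qed.
Local Hint Resolve measurable_executes : core.

Lemma measurable_work P a b : measurable (executes x P `&` `[a, b[)%classic.
Proof. by apply: measurableI. Qed.
Local Hint Resolve measurable_work : core.

Lemma lebesgue_itv_co a b : a <= b -> lebesgue_measure `[a, b[%classic = (b - a)%:E.
Proof.
move=> ab; rewrite lebesgue_measure_itv /= lte_fin; case: ltP => [|ba].
  by rewrite EFinN -EFinD.
by have /eqP -> : a == b by [rewrite eq_le ab]; rewrite subrr.
Qed.

Lemma workE P a b : a <= b ->
  lebesgue_measure (executes x P `&` `[a, b[)%classic = (work x P a b)%:E.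
Proof.
move=> ab; rewrite /work fineK // ge0_fin_numE //.
apply: (@le_lt_trans _ _ (lebesgue_measure `[a, b[%classic)).
  by apply: le_measure; rewrite ?inE //; exact: subIsetr.
by rewrite lebesgue_itv_co // ltry.
Qed.

Lemma work_ge0 P a b : 0 <= work x P a b.
Proof. by rewrite /work fine_ge0. Qed.

Lemma work_le P a b : a <= b -> work x P a b <= b - a.
Proof.
move=> ab; rewrite -lee_fin -workE // -lebesgue_itv_co //.
by apply: le_measure; rewrite ?inE //; exact: subIsetr.
Qed.

Lemma work_cat P a b c : a <= b -> b <= c ->
  work x P a c = work x P a b + work x P b c.
Proof.
move=> ab bc; have ac := le_trans ab bc.
apply: EFin_inj; rewrite EFinD -!workE // -measureU //; last first.
  rewrite -subset0 => u /= []; rewrite !in_itv /= => -[_ /andP[_ ub]] [_ /andP[bu _]].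
  by move: ub; rewrite ltNge bu.
rewrite -setIUr; congr (lebesgue_measure (_ `&` _)%classic).
apply/seteqP; split => u /=; rewrite !in_itv /=.
  by case/andP => -> ->; case: (ltP u b) => _; [left|right].
by case=> /andP[h1 h2]; apply/andP; split => //;
  [exact: lt_le_trans bc | exact: le_trans h1].
Qed.

Lemma workU P Q a b : a <= b -> work x (predU P Q) a b <= work x P a b + work x Q a b.
Proof.
move=> ab; rewrite -lee_fin EFinD -!workE //.
apply: le_trans (measureU2 _ _ _) => //.
apply: le_measure; rewrite ?inE //; first by apply: measurableU.
move=> u /= []; rewrite /executes /=; case: (sched x u) => [s|] //=.
by case/orP => Ps uab; [left|right].
Qed.

(* The instant a itself is negligible. *)
Lemma work_sub P Q a b : a <= b ->
  (forall u s, a < u < b -> sched x u = Some s -> P s -> Q s) ->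
  work x P a b <= work x Q a b.
Proof.
move=> ab PQ; rewrite -lee_fin -!workE //.
rewrite -[leRHS]adde0 -(lebesgue_measure_set1 a).
apply: le_trans (measureU2 _ _ _) => //.
apply: le_measure; rewrite ?inE //; first by apply: measurableU.
move=> u /= []; rewrite /executes in_itv /=; case E : (sched x u) => [s|] //= Ps /andP[au ub].
move: au; rewrite le_eqVlt => /orP[/eqP ->|au]; first by right.
have uab : a < (u : R) < b by rewrite au.
by left; split; [exact: PQ uab E Ps | rewrite au ub orbT].
Qed.

Lemma work_pred0 a b : work x pred0 a b = 0.
Proof.
rewrite /work (_ : (_ `&` _)%classic = set0) ?measure0 //.
by rewrite -subset0 => u /= []; rewrite /executes /=; case: (sched x u).
Qed.

Lemma work_eq0 P a b : a <= b ->
  (forall u s, a < u < b -> sched x u = Some s -> ~~ P s) -> work x P a b = 0.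
Proof.
move=> ab Pn; apply/eqP; rewrite eq_le work_ge0 -(work_pred0 a b) andbT.
by apply: work_sub => // u s uab us /(negP (Pn u s uab us)).
Qed.

Lemma work_full P a b : a <= b ->
  (forall u, a < u < b -> exists2 s, sched x u = Some s & P s) -> work x P a b = b - a.
Proof.
move=> ab full; apply/eqP; rewrite eq_le work_le //=.
rewrite -lee_fin -workE // -lebesgue_itv_co //.
rewrite -[leRHS]adde0 -(lebesgue_measure_set1 a).
apply: le_trans (measureU2 _ _ _) => //.
apply: le_measure; rewrite ?inE //; first by apply: measurableU.
move=> u /=; rewrite in_itv /= => /andP[au ub].
move: au; rewrite le_eqVlt => /orP[/eqP ->|au]; first by right.
left; split; last by rewrite au ub orbT.
by rewrite /executes /=; have [|s -> //] := full u; rewrite au.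
Qed.

Lemma work_has (I : eqType) (r : seq I) (P : I -> pred segment) a b : a <= b ->
  work x (fun s => has (P^~ s) r) a b <= \sum_(i <- r) work x (P i) a b.
Proof.
move=> ab; elim: r => [|i r IH]; first by rewrite big_nil work_pred0.
by rewrite big_cons; apply: le_trans (workU _ _ _ _ ab) _; rewrite lerD2l.
Qed.

Lemma serviceE s t : service x s t = work x (pred1 s) 0 t.
Proof.
rewrite /service /work; congr (fine (lebesgue_measure (_ `&` _)%classic)).
apply/seteqP; split => u; rewrite /exec_set /executes /=.
  by move=> ->; rewrite eqxx.
by case: (sched x u) => // s' /eqP ->.
Qed.

Lemma service_ge0 s t : 0 <= service x s t.
Proof. by rewrite serviceE work_ge0. Qed.

Lemma serviceD s t u : 0 <= t -> t <= u ->
  service x s u = service x s t + work x (pred1 s) t u.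
Proof. by move=> t0 tu; rewrite !serviceE -work_cat. Qed.

Lemma service_le s t : 0 <= t -> service x s t <= t.
Proof. by move=> t0; rewrite serviceE (le_trans (work_le _ _ _ t0))// subr0. Qed.

Lemma service_mono s t u : 0 <= t -> t <= u -> service x s t <= service x s u.
Proof. by move=> t0 tu; rewrite (serviceD _ _ _ t0 tu) lerDl work_ge0. Qed.

Lemma service_lip s t u : 0 <= t -> t <= u -> service x s u <= service x s t + (u - t).
Proof. by move=> t0 tu; rewrite (serviceD _ _ _ t0 tu) lerD2l work_le. Qed.

End Work.

(** * Finishing times, busy periods and demand bounds in legal runs *)

Section LegalRuns.
Context {R : realType} (ts : taskset R) (x : @run R) (lx : legal_run ts x).
Implicit Types (a b t u : R) (s : segment).

Let mx := legal_measurable lx.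

Lemma sched_ready t i k j : sched x t = Some (i, k, j) ->
  [/\ (1 <= i <= ntasks ts)%N, (1 <= j <= task_nsegs ts i)%N,
      (ready_time x i k j <= t%:E)%E & service x (i, k, j) t < cost x i k j].
Proof. exact: legal_ready. Qed.

(** A segment executes only while its service is below its cost, and service is 1-Lipschitz in time.
    Past the last instant at which service is at most the cost, the segment can no longer
    execute. *)
Lemma service_le_cost i k j t :
  (1 <= i <= ntasks ts)%N -> (1 <= j <= task_nsegs ts i)%N -> 0 <= t ->
  service x (i, k, j) t <= cost x i k j.
Proof.
move=> hi hj t0; set s := (i, k, j); rewrite leNgt; apply/negP => clt.
have /andP[c0 _] := legal_cost lx k hi hj.
pose A : set R := [set u | 0 <= u <= t /\ service x s u <= cost x i k j].
have A0 : A 0.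
  by split; [rewrite lexx|apply: le_trans c0; apply: service_le].
have ubA : has_ubound A by exists t => u [/andP[]].
have supA : has_sup A by split; [exists 0|].
have s0 : 0 <= sup A by apply: ub_le_sup.
have st : sup A <= t by apply: ge_sup; [exists 0|move=> u [/andP[]]].
have sA : service x s (sup A) <= cost x i k j.
  rewrite leNgt; apply/negP => d0.
  have [|u Au ult] := @sup_adherent _ A (service x s (sup A) - cost x i k j) _ supA.
    by rewrite subr_gt0.
  have us := ub_le_sup ubA Au; case: Au => /andP[u0 _] uc.
  by have := service_lip _ mx s _ _ u0 us; lra.
have := serviceD _ mx s _ _ s0 st; rewrite work_eq0 // => [|u s' /andP[su ut] E].
  by rewrite addr0 => E; move: sA; rewrite -E leNgt clt.
apply/negP => /eqP Es; move: E; rewrite Es => /sched_ready[_ _ _ uc].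
have Au : A u by split; [rewrite (le_trans s0 (ltW su)) ltW|exact: ltW].
by have := ub_le_sup ubA Au; rewrite leNgt su.
Qed.

Lemma finish_from_ge s (a : \bar R) : (a <= finish_from x s a)%E.
Proof. by apply: le_ereal_inf_tmp => _ [t [at_ _] <-]. Qed.

(** Service is continuous, so the infimum in [finish_from] is attained once the cost is reached at
    all. *)
Lemma finish_fromP i k j a t : 0 <= a -> a <= t ->
  cost x i k j <= service x (i, k, j) t ->
  exists b, [/\ a <= b <= t, finish_from x (i, k, j) a%:E = b%:E,
    cost x i k j <= service x (i, k, j) b &
    forall u, a <= u < b -> service x (i, k, j) u < cost x i k j].
Proof.
move=> a0 at_ ct; set s := (i, k, j).
pose B : set R := [set u | a <= u /\ cost x i k j <= service x s u].
have Bt : B t by [].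
have lbB : has_lbound B by exists a => u [].
have infB : has_inf B by split; [exists t|].
have ab : a <= inf B by apply: lb_le_inf; [exists t|move=> u []].
have bt : inf B <= t by apply: ge_inf.
have cb : cost x i k j <= service x s (inf B).
  rewrite leNgt; apply/negP => d0.
  have [|u Bu ult] := @inf_adherent _ B (cost x i k j - service x s (inf B)) _ infB.
    by rewrite subr_gt0.
  have bu := ge_inf lbB Bu; case: Bu => _ uc.
  by have := service_lip _ mx s _ _ (le_trans a0 ab) bu; lra.
exists (inf B); split => //; first by rewrite ab.
  rewrite -ereal_inf_EFin //; last by exists t.
move=> u /andP[au ub]; rewrite ltNge; apply/negP => uc.
by have := ge_inf lbB (conj au uc); rewrite leNgt ub.
Qed.

Lemma finish_le_ready i k j j' : (1 <= i <= ntasks ts)%N ->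
  (1 <= j < j')%N -> (j' <= task_nsegs ts i)%N ->
  (finish_time x i k j <= ready_time x i k j')%E.
Proof.
move=> hi; elim: j' => [|j' IH]; first by rewrite ltn0 andbF.
case/andP=> j1; rewrite ltnS leq_eqVlt => jj' hj'.
have j'0 : (0 < j')%N by case/orP: jj' => [/eqP <- //|]; apply: leq_ltn_trans.
have su : (0%:E <= (susp x i k j')%:E)%E.
  have : (j'.+1 <= task_nsegs ts i)%N by [].
  rewrite /task_nsegs; case: eqP => [->|_]; last by rewrite ltnS leqNgt j'0.
  by move=> h; rewrite lee_fin; have := @legal_susp _ _ _ lx k j'; rewrite j'0 h => /(_ isT)/andP[].
have -> : ready_time x i k j'.+1 = (finish_time x i k j' + (susp x i k j')%:E)%E.
  by case: (j') j'0.
case/orP: jj' => [/eqP ->|jj']; first exact: leeDl su.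
apply: (le_trans (IH _ (ltnW hj'))); first by rewrite j1.
by apply: (le_trans (finish_from_ge _ _)); exact: leeDl su.
Qed.

Lemma release_le_ready i k j : (1 <= i <= ntasks ts)%N -> (1 <= j <= task_nsegs ts i)%N ->
  ((release x i k)%:E <= ready_time x i k j)%E.
Proof.
move=> hi /andP[]; rewrite leq_eqVlt => /orP[/eqP <- //|j1 hj].
by apply: le_trans (@finish_le_ready i k 1 j hi j1 hj); exact: finish_from_ge.
Qed.

Lemma releaseD i k l : (1 <= i <= ntasks ts)%N ->
  release x i k + l%:R * period ts i <= release x i (k + l).
Proof.
move=> hi; elim: l => [|l IH]; first by rewrite mul0r addr0 addn0.
rewrite addnS; apply: le_trans (legal_sporadic lx (k + l) hi).
by rewrite -(natr1 l) mulrDl mul1r addrA lerD2r.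
Qed.

Lemma release_ge0 i k : (1 <= i <= ntasks ts)%N -> 0 <= period ts i -> 0 <= release x i k.
Proof.
move=> hi pi; have := releaseD i 0 k hi; apply: le_trans.
by rewrite addr_ge0 ?mulr_ge0 ?(legal_start lx).
Qed.

(** Only segment 1 appears because this is applied to ordinary tasks. The strict inequality leaves
    out jobs released at [t] itself, so that a limit from the left of caught-up instants is again
    caught up. *)
Definition caught_up (p : nat) t := forall i k, (1 <= i <= p)%N ->
  release x i k < t -> cost x i k 1 <= service x (i, k, 1%N) t.

Definition level (p : nat) : pred segment := fun s => (s.1.1 <= p)%N.

Definition of_task (i : nat) : pred segment := fun s => s.1.1 == i.

Lemma busy_pending i k t : (1 <= i < ntasks ts)%N -> release x i k <= t ->
  service x (i, k, 1%N) t < cost x i k 1 ->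
  exists2 s, sched x t = Some s & level i s.
Proof.
move=> hi rt st; have [|i' [k' [j' [-> i'i]]]] := @legal_priority _ _ _ lx t i k 1%N; last first.
  by exists (i', k', j').
split => //; rewrite ?lee_fin //; first by case/andP: hi => -> /ltnW ->.
by rewrite /task_nsegs; case: eqP hi => [->|//]; rewrite ltnn andbF.
Qed.

(** The instant [a] is the supremum of the caught-up instants up to [t]. It is caught up itself, and
    at any later instant some job of a task at most [p] is pending and keeps the processor at that
    level. *)
Lemma last_caught_up p t : (p < ntasks ts)%N ->
  (forall i, (1 <= i <= p)%N -> 0 <= period ts i) -> 0 <= t ->
  exists a, [/\ 0 <= a <= t, caught_up p a &
    forall u, a < u <= t -> exists2 s, sched x u = Some s & level p s].
Proof.
move=> pn pp t0; pose A : set R := [set u | 0 <= u <= t /\ caught_up p u].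
have A0 : A 0.
  split; [by rewrite lexx|move=> i k /andP[i1 ip]].
  rewrite ltNge release_ge0 ?i1 //; last by apply: pp; rewrite i1.
  exact: leq_trans ip (ltnW pn).
have ubA : has_ubound A by exists t => u [/andP[]].
have supA : has_sup A by split; [exists 0|].
have s0 : 0 <= sup A by apply: ub_le_sup.
have st : sup A <= t by apply: ge_sup; [exists 0|move=> u [/andP[]]].
exists (sup A); split; first by rewrite s0.
  move=> i k hi rs.
  have [|u Au ult] := @sup_adherent _ A (sup A - release x i k) _ supA.
    by rewrite subr_gt0.
  have us := ub_le_sup ubA Au; case: Au => /andP[u0 _] cu.
  apply: le_trans (service_mono _ mx _ _ _ u0 us); apply: cu => //; lra.
move=> u /andP[su ut].
have /existsNP[i /existsNP[k /not_implyP[hi /not_implyP[ru /negP]]]] : ~ caught_up p u.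
  move=> cu; have : u <= sup A by apply: ub_le_sup => //; rewrite /A /= ut (le_trans s0 (ltW su)).
  by rewrite leNgt su.
rewrite -ltNge => uc; case/andP: hi => i1 ip.
have iN : (1 <= i < ntasks ts)%N by rewrite i1 (leq_ltn_trans ip).
have [s us ls] := @busy_pending i k u iN (ltW ru) uc.
by exists s => //; exact: leq_trans ls ip.
Qed.

(** Nothing is carried into a caught-up instant: only jobs released from [a] on execute, and these
    are a period apart. *)
Lemma task_demand p i (n : nat) a L : (1 <= i <= p)%N -> (p < ntasks ts)%N ->
  caught_up p a -> 0 <= a -> 0 <= L -> 0 < period ts i -> L <= n%:R * period ts i ->
  work x (of_task i) a (a + L) <= n%:R * wcet ts i.
Proof.
move=> hip pn ca a0 L0 T0 LnT.
have hi : (1 <= i <= ntasks ts)%N.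
  by case/andP: hip => -> ip; rewrite (leq_trans ip) // ltnW.
have ni : i != ntasks ts by case/andP: hip => _ ip; rewrite ltn_eqF // (leq_ltn_trans ip).
have seg1 : task_nsegs ts i = 1%N by rewrite /task_nsegs (negbTE ni).
have exk : exists k, a <= release x i k.
  exists (Num.bound (a / period ts i)).
  have := releaseD i 0 (Num.bound (a / period ts i)) hi; apply: le_trans.
  rewrite -[leLHS]add0r lerD ?(legal_start lx) // -ler_pdivrMr //.
    by apply/ltW/archi_boundP; rewrite divr_ge0 // ltW.
(* [k0] is the first job released at or after [a]; job [k0 + n] is released too late to run in the
   window. *)
have [k0 ak0 mink] := ex_minnP exk.
have aL : a <= a + L by rewrite lerDl.
apply: (@le_trans _ _ (work x (fun s => has (fun l => pred1 (i, (k0 + l)%N, 1%N) s) (index_iota 0 n)) a (a + L))).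
  apply: work_sub => // u [[i' k] j] /andP[au uL] us /eqP /= ii; subst i'.
  have [_ hj rk sc] := sched_ready u i k j us.
  have j1 : j = 1%N by move: hj; rewrite seg1 -eqn_leq => /eqP.
  subst j; rewrite /= lee_fin in rk.
  have kk0 : (k0 <= k)%N.
    apply: mink; rewrite leNgt; apply/negP => ra.
    have := service_mono _ mx (i, k, 1%N) _ _ a0 (ltW au).
    by move/(le_trans (ca i k hip ra)); rewrite leNgt sc.
  apply/hasP; exists (k - k0)%N; last by rewrite /= subnKC.
  rewrite mem_index_iota /= ltnNge; apply/negP => nk.
  have := releaseD i k0 (k - k0) hi; rewrite subnKC // leNgt => /negP; apply.
  apply: (le_lt_trans rk); apply: (lt_le_trans uL); apply: lerD => //.
  by apply: (le_trans LnT); rewrite ler_pM2r // ler_nat.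
apply: (le_trans (work_has _ mx _ _ _ _ _ aL)).
rewrite mulr_natl -[X in _ *+ X]subn0 -sumr_const_nat; apply: ler_sum_nat => l _.
have := serviceD _ mx (i, (k0 + l)%N, 1%N) _ _ a0 aL.
have := service_ge0 x (i, (k0 + l)%N, 1%N) a.
have := service_le_cost i (k0 + l) 1 (a + L) hi; rewrite seg1 => /(_ isT (le_trans a0 aL)).
have := legal_cost lx (k0 + l) hi (j := 1); rewrite seg1 => /(_ isT).
rewrite /task_seg_wcet (negbTE ni); lra.
Qed.

Lemma level_demand p (n : nat -> nat) a L : (p < ntasks ts)%N ->
  caught_up p a -> 0 <= a -> 0 <= L ->
  (forall i, (1 <= i <= p)%N -> 0 < period ts i /\ L <= (n i)%:R * period ts i) ->
  work x (level p) a (a + L) <= \sum_(1 <= i < p.+1) (n i)%:R * wcet ts i.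
Proof.
move=> pn ca a0 L0 hn; have aL : a <= a + L by rewrite lerDl.
apply: (@le_trans _ _ (work x (fun s => has (of_task^~ s) (index_iota 1 p.+1)) a (a + L))).
  apply: work_sub => // u [[i k] j] _ /sched_ready[/andP[i1 _] _ _ _] ip.
  by apply/hasP; exists i; rewrite /of_task //= mem_index_iota i1.
apply: (le_trans (work_has _ mx _ _ _ _ _ aL)).
apply: ler_sum_nat => i; rewrite ltnS => hi; have [T0 LT] := hn i hi.
exact: task_demand hi pn ca a0 L0 T0 LT.
Qed.

End LegalRuns.

(** One window of length 8m for each of the m segments and each of the m tasks 4, ..., m + 3 makes
    16m^2; the rest is the total suspension time. *)
Definition resp_bound {R : realType} (m : nat) : R :=
  16 * m%:R ^+ 2 + (m%:R - 1) * (2 * m%:R - 1).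

(** * Upper bound on the response time of the suspending task *)

Section ResponseTime.
Context {R : realType} (m : nat) (eps Tn : R).
Implicit Types (a t r u : R).
Hypotheses (m_ge2 : (2 <= m)%N) (eps_gt0 : 0 < eps) (eps_lt1 : eps < 1).

Local Notation ts := (T_MILP m m eps Tn).
Local Notation M := (m%:R : R).
Local Notation Tlow := (16 * M * M ^+ 2 + (M - 1) * (2 * M - 1)).
Local Notation L := (resp_bound m : R).

Hypothesis Tn_ge : L <= Tn.

Lemma param_bounds : [/\ 2 <= M, 0 < eps & eps < 1].
Proof. by rewrite ler_nat. Qed.

Lemma period_high (i : nat) : (4 <= i < m + 4)%N -> period ts i = Tlow.
Proof.
by case/andP=> i4 im; rewrite /= ltn_eqF //; move: i i4 {im} => [|[|[|[|]]]].
Qed.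

Lemma wcet_high (i : nat) : (4 <= i)%N -> wcet ts i = 1 - eps.
Proof. by move: i => [|[|[|[|]]]]. Qed.

Lemma period_low :
  [/\ period ts 1 = 2, period ts 2 = 4 * M & period ts 3 = 8 * M].
Proof. by rewrite /= !ltn_eqF ?addn4. Qed.

Lemma sum_tasks_low (F : nat -> R) : \sum_(1 <= i < 4) F i = F 1%N + F 2%N + F 3%N.
Proof. by rewrite -[index_iota 1 4]/[:: 1; 2; 3]%N !big_cons big_nil addr0 addrA. Qed.

Lemma sum_tasks (F : nat -> R) : \sum_(1 <= i < m + 4) F i =
  F 1%N + F 2%N + F 3%N + \sum_(4 <= i < m + 4) F i.
Proof. by rewrite (big_cat_nat (n := 4)) ?leq_addl //= sum_tasks_low. Qed.

Context (x : @run R) (lx : legal_run ts x).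
Let mx := legal_measurable lx.

Lemma period_gt0 (i : nat) : (1 <= i < m + 4)%N -> 0 < period ts i.
Proof.
case/andP=> i1 im; have [M2 e0 e1] := param_bounds; have [T1 T2 T3] := period_low.
case: (ltnP i 4) => i4; last by rewrite period_high ?i4 //; nra.
by case: i i1 i4 im => [|[|[|[|]]]] // _ _ _; rewrite ?T1 ?T2 ?T3; lra.
Qed.

(** 8m is the hyperperiod of tasks 1, 2, 3, with 4m, 2 and 1 jobs: 4m + 2m + (2m - 1 + eps) = 8m -
    (1 - eps). *)
Lemma low_demand a : 0 <= a -> caught_up x 3 a ->
  work x (level 3) a (a + 8 * M) <= 8 * M - (1 - eps).
Proof.
move=> a0 ca; have [M2 e0 e1] := param_bounds; have [T1 T2 T3] := period_low.
pose n (i : nat) := match i with 1 => 4 * m | 2 => 2 | _ => 1 end%N.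
have n3 : (3 < ntasks ts)%N by rewrite /= addn4.
apply: le_trans (level_demand _ _ lx 3 n a (8 * M) n3 ca a0 _ _) _.
- by lra.
- move=> i /andP[i1 i3]; split.
    by apply: period_gt0; rewrite i1 addn4 ltnS (leq_trans i3).
  by case: i i1 i3 => [|[|[|[|]]]] // _ _; rewrite ?T1 ?T2 ?T3 /= ?natrM; lra.
- by rewrite sum_tasks_low /= natrM; lra.
Qed.

(** Carry-in is removed by going back to the last caught-up instant [s]. It is less than 8m before
    [a], since otherwise the window from [s] would be fully busy, against [low_demand]. The busy
    stretch from [s] to [a] then makes up for the stretch of the same length added at the end. *)
Lemma low_supply a : 0 <= a -> work x (level 3) a (a + 8 * M) <= 8 * M - (1 - eps).
Proof.
move=> a0; have [M2 e0 e1] := param_bounds.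
have [||s [/andP[s0 sa] cs busy]] := @last_caught_up _ _ _ lx 3 a _ _ a0.
- by rewrite /= addn4.
- move=> i /andP[i1 i3]; apply: ltW.
  by apply: period_gt0; rewrite i1 addn4 ltnS (leq_trans i3).
have dem := low_demand s s0 cs.
case: (lerP (s + 8 * M) a) => sMa.
  have : work x (level 3) s (s + 8 * M) = s + 8 * M - s.
    apply: (work_full _ mx) => [|u /andP[su us]]; first by lra.
    by apply: busy; rewrite su (le_trans (ltW us)).
  lra.
have full : work x (level 3) s a = a - s.
  by apply: (work_full _ mx) => // u /andP[su ua]; apply: busy; rewrite su ltW.
have := work_cat _ mx (level 3) s a (s + 8 * M) sa (ltW sMa).
have -> : work x (level 3) a (a + 8 * M) =
    work x (level 3) a (s + 8 * M) + work x (level 3) (s + 8 * M) (a + 8 * M).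
  by apply: (work_cat _ mx); lra.
have : work x (level 3) (s + 8 * M) (a + 8 * M) <= (a + 8 * M) - (s + 8 * M).
  by apply: (work_le _ mx); lra.
lra.
Qed.

Lemma low_supplyM a (K : nat) : 0 <= a ->
  work x (level 3) a (a + 8 * M * K%:R) <= K%:R * (8 * M - (1 - eps)).
Proof.
move=> a0; have [M2 e0 e1] := param_bounds; elim: K => [|K IH].
  by rewrite mulr0 mul0r addr0 (le_trans (work_le _ mx _ _ _ _)) // subrr.
have K0 : 0 <= K%:R :> R by [].
have MK0 : 0 <= 8 * M * K%:R by rewrite !mulr_ge0.
rewrite -(natr1 K) mulrDr mulr1 addrA (work_cat _ mx _ a (a + 8 * M * K%:R)); [|lra|lra].
have := low_supply (a + 8 * M * K%:R).
move=> /(_ (addr_ge0 a0 MK0)); lra.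
Qed.

(** In a window of length 8m(m + 1) after a caught-up instant, tasks 1, 2, 3 demand at most (m +
    1)(8m - (1 - eps)), and the other m tasks, whose period is at least that long, one job each. The
    total is 1 - eps short of the window, so it cannot be fully busy. *)
Lemma recently_caught_up t : 0 <= t ->
  exists a, [/\ 0 <= a <= t, t < a + 8 * M * (M + 1) & caught_up x (m + 3) a].
Proof.
move=> t0; have [M2 e0 e1] := param_bounds; have [T1 T2 T3] := period_low.
have mn : (m + 3 < m + 4)%N by rewrite ltn_add2l.
have pos i : (1 <= i <= m + 3)%N -> 0 < period ts i.
  by move=> hi; apply: period_gt0; rewrite addnS ltnS.
have [|s [/andP[s0 st] cs busy]] := @last_caught_up _ _ _ lx (m + 3) t mn _ t0.
  by move=> i /pos/ltW.
exists s; split; rewrite ?s0 // ltNge; apply/negP => sMt.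
pose n (i : nat) := match i with 1 => 4 * m * m.+1 | 2 => 2 * m.+1 | 3 => m.+1 | _ => 1 end%N.
pose w := 8 * M * (M + 1).
have w0 : 0 <= w by rewrite /w; nra.
have := level_demand _ _ lx (m + 3) n s w mn cs s0 w0.
have -> : work x (level (m + 3)) s (s + w) = w.
  rewrite (work_full _ mx) ?lerDl //; first by rewrite addrC addKr.
  by move=> u /andP[su us]; apply: busy; rewrite su (le_trans (ltW us)).
rewrite -addnS sum_tasks (eq_big_nat _ _ (F2 := fun=> 1 - eps)); last first.
  by move=> i /andP[i4 _]; rewrite wcet_high //; case: i i4 => [|[|[|[|]]]] // i _; rewrite mul1r.
rewrite sumr_const_nat addnK -mulr_natl /= !natrM -(natr1 m).
suff n_ok i : (0 < i <= m + 3)%N -> 0 < period ts i /\ w <= (n i)%:R * period ts i.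
  by move/(_ n_ok); rewrite /w; nra.
move=> hi; split; first exact: pos.
case: (ltnP i 4) => i4.
  by case: i hi i4 => [|[|[|[|]]]] // _ _; rewrite ?T1 ?T2 ?T3 /n ?natrM -?(natr1 m) /w; lra.
rewrite period_high; last by rewrite i4 addnS ltnS; case/andP: hi.
have -> : n i = 1%N by case: i i4 {hi} => [|[|[|[|]]]].
rewrite mul1r /w.
have : 0 <= (M - 1) * (2 * M - 1) by nra.
have : 8 * M * (M + 1) <= 16 * M * M ^+ 2 by rewrite expr2; nra.
lra.
Qed.

Lemma high_range (i : nat) : (4 <= i < m + 4)%N ->
  [/\ (1 <= i <= m + 3)%N, (1 <= i < ntasks ts)%N, (1 <= i <= ntasks ts)%N & task_nsegs ts i = 1%N].
Proof.
case/andP=> i4 im; have i1 : (1 <= i)%N by apply: leq_trans i4.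
rewrite /task_nsegs /= i1 im (ltnW im) (ltn_eqF im); split => //.
by rewrite -ltnS -addnS.
Qed.

(** By [recently_caught_up] the earlier job is released less than 8m(m + 1) before it executes. The
    next one comes after [r + L], because the period exceeds [L] by at least that amount. *)
Lemma high_unique_job (i l l' j j' : nat) r u u' : (4 <= i < m + 4)%N ->
  0 <= r -> r <= u < r + L -> r <= u' < r + L ->
  sched x u = Some (i, l, j) -> sched x u' = Some (i, l', j') -> l = l'.
Proof.
move=> hi r0; wlog: l l' j j' u u' / (l <= l')%N => [W|].
  case: (leqP l l') => [ll'|/ltnW ll'] hu hu' E E'.
    exact: (W l l' j j' u u').
  by symmetry; exact: (W l' l j' j u' u).
rewrite leq_eqVlt => /orP[/eqP // |ll'] /andP[ru uL] /andP[ru' uL'] E E'.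
have [M2 e0 e1] := param_bounds.
have [hi3 _ i1 seg1] := high_range i hi.
have [_ hj rj sj] := sched_ready _ _ lx _ _ _ _ E.
have [_ hj' rj' _] := sched_ready _ _ lx _ _ _ _ E'.
have [j1 j1'] : j = 1%N /\ j' = 1%N.
  by move: hj hj'; rewrite seg1 -!eqn_leq => /eqP <- /eqP <-.
subst j j'; rewrite /= !lee_fin in rj rj'.
have u0 : 0 <= u by apply: le_trans ru.
have [a [/andP[a0 au] ua ca]] := recently_caught_up u u0.
have ra : a <= release x i l.
  rewrite leNgt; apply/negP => /(ca i l hi3) c.
  by have := service_mono _ mx (i, l, 1%N) _ _ a0 au; lra.
have := releaseD _ _ lx i l (l' - l) i1; rewrite subnKC ?(ltnW ll') // period_high //.
have d1 : 1 <= (l' - l)%:R :> R by rewrite ler1n subn_gt0.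
have c0 : 0 <= (M - 1) * (2 * M - 1) by apply: mulr_ge0; lra.
have M2M : 2 * M ^+ 2 <= M * M ^+ 2 by rewrite ler_wpM2r // sqr_ge0.
have M1M : 2 * M <= M ^+ 2 by rewrite expr2 ler_wpM2r //; lra.
have slack : 16 * M ^+ 2 + 8 * M * (M + 1) <= 16 * M * M ^+ 2 by lra.
have T0 : 0 <= Tlow by have := sqr_ge0 M; lra.
have := ler_peMl T0 d1; move: {d1}(_%:R * Tlow) => d Td rd.
by exfalso; move: uL'; rewrite /resp_bound; lra.
Qed.

Definition active a t (i : nat) : bool :=
  `[< exists u l j, a <= u < t /\ sched x u = Some (i, l, j) >].

(** A potential for the horizon [t = r + L]: a task that runs during a segment of the suspending
    task is no longer counted from the end of that segment on. *)
Definition nactive a t : nat := count (active a t) (index_iota 4 (m + 4)).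

Lemma resp_bound_ge0 : 0 <= L.
Proof.
have [M2 _ _] := param_bounds; rewrite /resp_bound.
by apply: addr_ge0; apply: mulr_ge0; rewrite ?exprn_ge0 //; lra.
Qed.

Lemma period_own : period ts (m + 4) = Tn.
Proof. by rewrite /= eqxx. Qed.

Lemma nsegs_own : task_nsegs ts (m + 4) = m.
Proof. by rewrite /task_nsegs eqxx. Qed.

Lemma own_valid : (1 <= m + 4 <= ntasks ts)%N.
Proof. by rewrite /= leqnn addn4. Qed.

Lemma own_release_ge0 k : 0 <= release x (m + 4) k.
Proof.
apply: (release_ge0 _ _ lx _ _ own_valid).
by rewrite period_own (le_trans resp_bound_ge0).
Qed.

(** * One job of the suspending task, all earlier ones being complete at its release *)

Section Job.
Context (k : nat).
Local Notation r := (release x (m + 4) k).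
Hypothesis previous_done : forall k' j, (k' < k)%N -> (1 <= j <= m)%N ->
  cost x (m + 4) k' j <= service x (m + 4, k', j)%N r.

Lemma own_job u k' j : r <= u < r + L -> sched x u = Some (m + 4, k', j)%N -> k' = k.
Proof.
move=> /andP[ru uL] E; have [_ hj rk sc] := sched_ready _ _ lx _ _ _ _ E.
have r0 := own_release_ge0 k.
case: (ltngtP k' k) => // kk'; exfalso.
  have hj' : (1 <= j <= m)%N by rewrite -nsegs_own.
  have := service_mono _ mx (m + 4, k', j)%N _ _ r0 ru.
  by have := previous_done k' j kk' hj'; lra.
have := le_trans (release_le_ready _ _ lx _ k' _ own_valid hj) rk; rewrite lee_fin.
have := releaseD _ _ lx _ k (k' - k) own_valid; rewrite subnKC ?(ltnW kk') // period_own.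
have : 1 <= (k' - k)%:R :> R by rewrite ler1n subn_gt0.
have T0 := le_trans resp_bound_ge0 Tn_ge.
move/(ler_peMl T0) => T1 T2 T3; have : r + Tn <= u.
  by apply: le_trans T3; apply: le_trans T2; rewrite lerD2l.
by have := Tn_ge; lra.
Qed.

Section Segment.
Context (j : nat) (a : R).
Hypotheses (hj : (1 <= j <= m)%N) (ready_a : ready_time x (m + 4) k j = a%:E)
  (ra : r <= a)
  (earlier_done : forall j', (1 <= j' < j)%N ->
    cost x (m + 4) k j' <= service x (m + 4, k, j')%N a).
Local Notation seg := (m + 4, k, j)%N.

Lemma own_ready_ge0 : 0 <= a.
Proof. exact: le_trans (own_release_ge0 k) ra. Qed.

(** Earlier segments are complete at [a]. A later one is not ready at [u], since segment [j] still
    lacks execution time and can finish only after [u]. *)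
Lemma own_segment u k' j' : a <= u < r + L ->
  service x seg u < cost x (m + 4) k j ->
  sched x u = Some (m + 4, k', j')%N -> (k', j') = (k, j).
Proof.
move=> /andP[au uL] sc E; have u0 := le_trans own_ready_ge0 au.
have k'k : k' = k by apply: (own_job u k' j') E; rewrite uL (le_trans ra).
subst k'; have [_ hj' rj sc'] := sched_ready _ _ lx _ _ _ _ E.
have /andP[j'1 j'm] := hj'; have /andP[j1 jm] := hj.
congr (_, _); case: (ltngtP j' j) => // jj'; exfalso.
  have := earlier_done j'; rewrite j'1 jj' => /(_ isT).
  by have := service_mono _ mx (m + 4, k, j')%N _ _ own_ready_ge0 au; lra.
have := finish_le_ready _ _ lx _ k j j' own_valid; rewrite j1 jj' => /(_ isT j'm).
move/le_trans => /(_ _ rj); rewrite leNgt => /negP; apply.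
(* Service grows at rate at most 1, so the missing service bounds the finishing time from below.
   Negative [t] must be treated because the condition that [t] is past the ready time is dropped. *)
apply: (@lt_le_trans _ _ (u + (cost x (m + 4) k j - service x seg u))%:E).
  by rewrite lte_fin; lra.
apply: le_ereal_inf_tmp => _ [t [_ ct] <-]; rewrite lee_fin.
case: (ltP t u) => [tu|ut]; last by have := service_lip _ mx seg _ _ u0 ut; move: ct => /=; lra.
have [t0|t0] := ltP t 0.
  have : service x seg t = 0.
    by rewrite serviceE /work set_itv_ge ?setI0 ?measure0 // bnd_simp -leNgt ltW.
  by move: ct => /=; have := service_ge0 x seg u; lra.
by have := service_mono _ mx seg _ _ t0 (ltW tu); move: ct => /=; lra.
Qed.

Lemma high_work (i : nat) t : (4 <= i < m + 4)%N -> a <= t -> t <= r + L ->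
  work x (of_task i) a t <= (active a t i)%:R * (1 - eps).
Proof.
move=> hi at_ tL; have a0 := own_ready_ge0; have [M2 e0 e1] := param_bounds.
have [_ _ i1 seg1] := high_range i hi; have /andP[i4 im] := hi.
case: (asboolP (exists u l j, a <= u < t /\ sched x u = Some (i, l, j))) => act; last first.
  rewrite (work_eq0 _ mx) ?mulr_ge0 //; first by lra.
  move=> u [[i' l] j'] /andP[au ut] E; apply/negP => /eqP /= ii'; subst i'.
  by apply: act; exists u, l, j'; rewrite (ltW au).
rewrite /active asboolT // mul1r; case: act => u [l [j' [/andP[au ut] E]]].
apply: (@le_trans _ _ (work x (pred1 (i, l, 1%N)) a t)).
  apply: (work_sub _ mx) => // u' [[i' l'] j''] /andP[au' ut'] E' /eqP /= ii'; subst i'.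
  have <- : l = l'.
    apply: (high_unique_job i l l' j' j'' r u u' hi (own_release_ge0 k)) => //.
      by rewrite (le_trans ra au) (lt_le_trans ut).
    by rewrite (le_trans ra (ltW au')) (lt_le_trans ut').
  have [_ hj'' _ _] := sched_ready _ _ lx _ _ _ _ E'.
  by move: hj''; rewrite seg1 -eqn_leq => /eqP <-.
have := serviceD _ mx (i, l, 1%N) _ _ a0 at_.
have := service_ge0 x (i, l, 1%N) a.
have := service_le_cost _ _ lx i l 1 t i1; rewrite seg1 => /(_ isT (le_trans a0 at_)).
have := legal_cost lx l i1 (j := 1); rewrite seg1 => /(_ isT).
rewrite /task_seg_wcet (ltn_eqF im) wcet_high //.
lra.
Qed.

(** While the segment is pending the processor never idles. Tasks 1, 2, 3 leave at least K(1 - eps)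
    of the K windows, which goes to the segment itself or to active tasks among 4, ..., m + 3, at
    most 1 - eps each. *)
Lemma window_progress (K : nat) : a + 8 * M * K%:R <= r + L ->
  service x seg (a + 8 * M * K%:R) < cost x (m + 4) k j ->
  K%:R * (1 - eps) <=
    (nactive a (a + 8 * M * K%:R))%:R * (1 - eps) + service x seg (a + 8 * M * K%:R).
Proof.
set t := a + _ => tL sc; have a0 := own_ready_ge0; have [M2 e0 e1] := param_bounds.
have at_ : a <= t by rewrite lerDl !mulr_ge0.
have low := low_supplyM a K a0; rewrite -/t in low.
have inc u : a <= u -> u < t -> service x seg u < cost x (m + 4) k j.
  move=> au ut; apply: le_lt_trans sc; apply: (service_mono _ mx) (ltW ut).
  exact: le_trans au.
have full : work x predT a t = t - a.
  apply: (work_full _ mx) => // u /andP[au ut].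
  have [|i' [k' [j' [-> _]]]] := @legal_priority _ _ _ lx u (m + 4) k j; last first.
    by exists (i', k', j').
  by split; [exact: own_valid|rewrite nsegs_own|rewrite ready_a lee_fin ltW|apply: inc; rewrite ?ltW].
pose high : pred segment := fun s => has (of_task^~ s) (index_iota 4 (m + 4)).
have cover : work x predT a t <= work x (predU (level 3) (predU high (pred1 seg))) a t.
  apply: (work_sub _ mx) => // u [[i k'] j'] /andP[au ut] E _ /=.
  have [/andP[i1 im] _ _ _] := sched_ready _ _ lx _ _ _ _ E; rewrite /= in im.
  case: (leqP i 3) => i3; first by rewrite /level /= i3.
  case: (eqVneq i (m + 4)%N) => [im4|im4]; last first.
    rewrite (_ : high _) ?orbT //; apply/hasP; exists i; last exact: eqxx.
    by rewrite mem_index_iota i3 ltn_neqAle im4.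
  subst i; have [] : (k', j') = (k, j).
    apply: own_segment E; last by apply: inc; rewrite ?ltW.
    by rewrite (ltW au) (lt_le_trans ut).
  by move=> -> ->; rewrite eqxx !orbT.
have U1 := workU _ mx (level 3) (predU high (pred1 seg)) _ _ at_.
have U2 := workU _ mx high (pred1 seg) _ _ at_.
have U3 : work x high a t <= (nactive a t)%:R * (1 - eps).
  apply: (le_trans (work_has _ mx _ _ _ _ _ at_)).
  have -> : (nactive a t)%:R = \sum_(4 <= i < m + 4) (active a t i)%:R :> R.
    by rewrite /nactive -sum1_count big_mkcond natr_sum; apply: eq_bigr => i _; case: active.
  by rewrite mulr_suml; apply: ler_sum_nat => i hi; exact: high_work.
have := serviceD _ mx seg _ _ a0 at_; have := service_ge0 x seg a.
have : t - a = K%:R * (8 * M) by rewrite /t; ring.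
lra.
Qed.

(** The bound on [b] is amortized: one window for the segment, and one for each unit by which
    [nactive] drops between [a] and [b]. *)
Lemma segment_response : a + 8 * M * (1 + nactive a (r + L))%:R <= r + L ->
  exists b, [/\ finish_time x (m + 4) k j = b%:E, a <= b <= r + L,
    cost x (m + 4) k j <= service x seg b,
    (nactive b (r + L) <= nactive a (r + L))%N &
    b <= a + 8 * M * (1 + nactive a (r + L) - nactive b (r + L))%:R].
Proof.
set H := r + L => aH; have a0 := own_ready_ge0; have [M2 e0 e1] := param_bounds.
have C1 : cost x (m + 4) k j <= 1 - eps.
  have := legal_cost lx k own_valid (j := j); rewrite nsegs_own => /(_ hj) /andP[_].
  by rewrite /task_seg_wcet eqxx.
(* With at most [N] active tasks, more than [N] windows leave the segment at least 1 - eps, which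
   covers its cost. *)
have bound (N K : nat) : (nactive a (a + 8 * M * K%:R) <= N)%N -> (N < K)%N ->
    a + 8 * M * K%:R <= H -> cost x (m + 4) k j <= service x seg (a + 8 * M * K%:R).
  move=> nN NK KH; rewrite leNgt; apply/negP => sc.
  have e1' : 0 <= 1 - eps by lra.
  have nN' : (nactive a (a + 8 * M * K%:R))%:R * (1 - eps) <= N%:R * (1 - eps).
    by rewrite ler_wpM2r // ler_nat.
  have NK' : (N%:R + 1) * (1 - eps) <= K%:R * (1 - eps).
    by rewrite ler_wpM2r // natr1 ler_nat.
  have := window_progress K KH sc; lra.
have act_mono t t' : t <= t' -> {subset active a t <= active a t'}.
  move=> tt' i /asboolP[u [l [j' [/andP[au ut] E]]]]; apply/asboolP; exists u, l, j'.
  by rewrite au (lt_le_trans ut).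
have aH' : a <= H by apply: le_trans aH; rewrite lerDl !mulr_ge0.
have [|b [/andP[ab bt] fb cb inc]] := finish_fromP _ _ lx (m + 4) k j _ _ a0 _
    (bound (nactive a H) (1 + nactive a H)%N (sub_count (act_mono _ _ aH) _) (ltnSn _) aH).
  by rewrite lerDl !mulr_ge0.
have bH : b <= H := le_trans bt aH.
(* No task is active on both sides of [b]: by [high_unique_job] it would run the same job, and the
   segment, blocked from [u] to [b], would have reached its cost by [u] already. *)
have disj : (nactive a b + nactive b H <= nactive a H)%N.
  rewrite /nactive -count_predUI [X in (_ + X)%N](_ : _ = 0%N) ?addn0.
    apply: sub_count => i /orP[/(act_mono _ _ bH) //|].
    move=> /asboolP[u [l [j' [/andP[bu uH] E]]]]; apply/asboolP; exists u, l, j'.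
    by rewrite (le_trans ab).
  apply/eqP; rewrite -leqn0 leqNgt -has_count; apply/negP => /hasP[i].
  rewrite mem_index_iota => hi /= /andP[/asboolP[u [l [j1 [/andP[au ub] E]]]]].
  move=> /asboolP[u' [l' [j1' [/andP[bu' uH'] E']]]].
  have ll' : l = l'.
    apply: (high_unique_job i l l' j1 j1' r u u' hi (own_release_ge0 k)) => //.
      by rewrite (le_trans ra au) (lt_le_trans ub).
    by rewrite (le_trans ra (le_trans ab bu')).
  subst l'; have [_ i1 _ seg1] := high_range i hi.
  have [_ hj1 rl _] := sched_ready _ _ lx _ _ _ _ E.
  have [_ hj1' _ sl] := sched_ready _ _ lx _ _ _ _ E'.
  move: hj1 hj1'; rewrite seg1 -!eqn_leq => /eqP j11 /eqP j11'; subst j1 j1'.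
  rewrite /= lee_fin in rl.
  (* The job still pending at b keeps the segment from executing in [u, b). *)
  have idle : work x (pred1 seg) u b = 0.
    apply: (work_eq0 _ mx) (ltW ub) _ => v s /andP[uv vb] Ev.
    have [|s' Es' ls'] := busy_pending _ _ lx i l v i1 (le_trans rl (ltW uv)).
      apply: le_lt_trans sl; apply: (service_mono _ mx).
        exact: le_trans a0 (le_trans au (ltW uv)).
      exact: le_trans (ltW vb) bu'.
    move: Ev; rewrite Es' => -[<-]; apply/negP => /eqP s'E.
    by move: ls'; rewrite s'E /level /= leqNgt; case/andP: hi => _ ->.
  have := serviceD _ mx seg _ _ (le_trans a0 au) (ltW ub); rewrite idle addr0.
  by have := inc u; rewrite au ub => /(_ isT); move: cb; lra.
exists b; split => //.
- by rewrite /finish_time ready_a.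
- by rewrite ab.
- by apply: leq_trans disj; rewrite leq_addl.
(* Only tasks active before [b] matter: otherwise [bound] would complete the segment earlier than
   its finishing time [b]. *)
- apply: (@le_trans _ _ (a + 8 * M * (1 + nactive a b)%:R)); last first.
    rewrite lerD2l ler_wpM2l ?mulr_ge0 // ler_nat.
    have bN : (nactive b H <= nactive a H)%N := leq_trans (leq_addl _ _) disj.
    by rewrite -addnBA // leq_add2l leq_subRL // addnC.
  rewrite leNgt; apply/negP => tb.
  have at_ : a <= a + 8 * M * (1 + nactive a b)%:R by rewrite lerDl !mulr_ge0.
  have := inc (a + 8 * M * (1 + nactive a b)%:R); rewrite at_ tb => /(_ isT).
  rewrite ltNge => /negP; apply; apply: (bound (nactive a b)) => //.
    by apply: sub_count; apply: act_mono; exact: ltW.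
  exact: le_trans (ltW tb) bH.
Qed.

End Segment.

(** The windows paid for tasks that leave the count are absorbed by the drop of [nactive], so the
    bound only grows by the segment's own window of 8m. *)
Lemma segment_finish (j : nat) a : (1 <= j <= m)%N ->
  ready_time x (m + 4) k j = a%:E -> r <= a ->
  (forall j', (1 <= j' < j)%N -> cost x (m + 4) k j' <= service x (m + 4, k, j')%N a) ->
  a <= r + 8 * M * (j%:R - 1 + M - (nactive a (r + L))%:R) + (j%:R - 1) * (2 * M - 1) ->
  exists b, [/\ finish_time x (m + 4) k j = b%:E, r <= b,
    forall j', (1 <= j' <= j)%N -> cost x (m + 4) k j' <= service x (m + 4, k, j')%N b &
    b <= r + 8 * M * (j%:R + M - (nactive b (r + L))%:R) + (j%:R - 1) * (2 * M - 1)].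
Proof.
move=> hj rja ra done_a bound_a; have [M2 e0 e1] := param_bounds.
have a0 : 0 <= a := le_trans (own_release_ge0 k) ra.
have Mj : 8 * M * j%:R <= 8 * M * M.
  by rewrite ler_wpM2l ?mulr_ge0 // ler_nat; case/andP: hj.
have Sj : (j%:R - 1) * (2 * M - 1) <= (M - 1) * (2 * M - 1).
  rewrite ler_wpM2r ?lerD2r ?ler_nat //; last by case/andP: hj.
  by lra.
have [|b [fb /andP[ab _] cb nba bb]] := segment_response j a hj rja ra done_a.
  (* Even if all active tasks delay this segment, it ends by [r + L], as [segment_response]
     requires. *)
  rewrite natrD; apply: le_trans (_ : r + 8 * M * (j%:R + M) + (j%:R - 1) * (2 * M - 1) <= _).
    by lra.
  by rewrite /resp_bound; lra.
exists b; split => //; first exact: le_trans ab.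
  move=> j' /andP[j'1]; rewrite leq_eqVlt => /orP[/eqP -> //|j'j].
  apply: le_trans (service_mono _ mx _ _ _ a0 ab).
  by apply: done_a; rewrite j'1.
apply: (le_trans bb); rewrite natrB; last by apply: leq_trans nba _; rewrite leq_addl.
by rewrite natrD; lra.
Qed.

(** Initially [nactive] is at most m; a suspension adds at most 2m - 1 and cannot raise the
    count. *)
Lemma segment_ready (j : nat) : (1 <= j <= m)%N -> exists a,
  [/\ ready_time x (m + 4) k j = a%:E, r <= a,
    forall j', (1 <= j' < j)%N -> cost x (m + 4) k j' <= service x (m + 4, k, j')%N a &
    a <= r + 8 * M * (j%:R - 1 + M - (nactive a (r + L))%:R) + (j%:R - 1) * (2 * M - 1)].
Proof.
have [M2 e0 e1] := param_bounds.
elim: j => [//|j IH]; have [->|j0] := posnP j => hj.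
  exists r; split => // [j'|]; first by case: j'.
  have nm : (nactive r (r + L))%:R <= M.
    by rewrite ler_nat (leq_trans (count_size _ _)) // size_iota addnK.
  have : 0 <= 8 * M * (M - (nactive r (r + L))%:R) by rewrite !mulr_ge0 // subr_ge0.
  by lra.
have jm : (1 <= j < m)%N by rewrite j0; case/andP: hj.
have hj' : (1 <= j <= m)%N by rewrite j0 ltnW; case/andP: hj.
have [a [rja ra done_a bound_a]] := IH hj'.
have [b [fb rb done_b bound_b]] := segment_finish j a hj' rja ra done_a bound_a.
have /andP[s0 sS] := legal_susp lx k (j := j) jm; rewrite /= in s0 sS.
exists (b + susp x (m + 4) k j); split.
- have -> : ready_time x (m + 4) k j.+1 =
      (finish_time x (m + 4) k j + (susp x (m + 4) k j)%:E)%E by case: (j) j0.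
  by rewrite fb EFinD.
- by rewrite (le_trans rb) // lerDl.
- move=> j' hj1; apply: le_trans (done_b j' hj1) _.
  apply: (service_mono _ mx); last by rewrite lerDl.
  exact: le_trans (own_release_ge0 k) rb.
have : (nactive (b + susp x (m + 4) k j) (r + L))%:R <= (nactive b (r + L))%:R :> R.
  rewrite ler_nat; apply: sub_count => i /asboolP[u [l [j' [/andP[bu uH] E]]]].
  by apply/asboolP; exists u, l, j'; rewrite uH (le_trans _ bu) // lerDl.
have M0 : 0 <= 8 * M by lra.
by move/(ler_wpM2l M0); rewrite -(natr1 j); lra.
Qed.

Lemma job_finish : exists b, [/\ finish_time x (m + 4) k m = b%:E, b <= r + L, 0 <= b &
  forall j, (1 <= j <= m)%N -> cost x (m + 4) k j <= service x (m + 4, k, j)%N b].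
Proof.
have [M2 e0 e1] := param_bounds.
have hm : (1 <= m <= m)%N by rewrite leqnn ltnW.
have [a [rma ra done_a bound_a]] := segment_ready m hm.
have [b [fb rb done_b bound_b]] := segment_finish m a hm rma ra done_a bound_a.
exists b; split => //; last exact: le_trans (own_release_ge0 k) rb.
apply: (le_trans bound_b); rewrite /resp_bound.
have : 0 <= 8 * M * (nactive b (r + L))%:R by rewrite !mulr_ge0.
by lra.
Qed.

End Job.

(** Strong induction on [k] discharges [previous_done]: each earlier job finishes within [L], hence
    within the period [Tn]. *)
Lemma previous_jobs_done k k' j : (k' < k)%N -> (1 <= j <= m)%N ->
  cost x (m + 4) k' j <= service x (m + 4, k', j)%N (release x (m + 4) k).
Proof.
elim/ltn_ind: k k' j => k IH k' j kk' hj.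
have [b [_ br b0 /(_ j hj) cb]] := job_finish k' (fun k'' j' => IH k' kk' k'' j').
apply: le_trans cb _; apply: (service_mono _ mx) => //; apply: (le_trans br).
have := releaseD _ _ lx _ k' (k - k') own_valid; rewrite subnKC ?(ltnW kk') // period_own.
apply: le_trans; rewrite lerD2l (le_trans Tn_ge) //.
have T0 := le_trans resp_bound_ge0 Tn_ge.
by rewrite ler_peMl // ler1n subn_gt0.
Qed.

Lemma response_time_le k : (response_time ts x k <= L%:E)%E.
Proof.
have [b [fb bL _ _]] := job_finish k (fun k' j => previous_jobs_done k k' j).
by rewrite /response_time fb -EFinN -EFinD lee_fin; lra.
Qed.

End ResponseTime.

(** * Positivity of the worst-case response time *)

Section SingleJob.
Context {R : realType} (ts : taskset R) (c : R).
Hypotheses (ntasks_gt0 : (0 < ntasks ts)%N) (nsegs_gt0 : (0 < nsegs ts)%N)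
  (c_gt0 : 0 < c) (c_le : c <= seg_wcet ts 1)
  (wcet_ge0 : forall i j, (1 <= i <= ntasks ts)%N -> (1 <= j <= task_nsegs ts i)%N ->
    0 <= task_seg_wcet ts i j)
  (susp_ge0 : forall j, (1 <= j < nsegs ts)%N -> 0 <= seg_susp ts j).

Let seg : segment := (ntasks ts, 0, 1)%N.

(** All costs are 0 except that of the first segment of the first job of the suspending task, which
    runs alone from 0 to [c]. The response time of that job is at least [c]. *)
Definition single_job_run : @run R := {|
  release := fun i k => k%:R * period ts i;
  cost := fun i k j => if (i, k, j) == seg then c else 0;
  susp := fun _ _ _ => 0;
  sched := fun t => if 0 <= t < c then Some seg else None
|}.

Local Notation x := single_job_run.

Lemma single_job_measurable s : measurable (exec_set x s).
Proof.
have [->|ns] := eqVneq s seg.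
  rewrite (_ : exec_set _ _ = `[0, c[%classic) //; apply/seteqP; split => u /=;
    by rewrite /exec_set /= in_itv /=; case: ifP.
rewrite (_ : exec_set _ _ = set0) // -subset0 => u; rewrite /exec_set /=.
by case: ifP => // _ [sE]; rewrite sE eqxx in ns.
Qed.

Let mx := single_job_measurable.

Lemma single_job_legal : legal_run ts x.
Proof.
split => //=.
- by move=> i _; rewrite mul0r.
- by move=> i k _; rewrite -(natr1 k) mulrDl mul1r.
- move=> i k j hi hj; case: eqP => [[-> _ ->]|_]; last by rewrite lexx wcet_ge0.
  by rewrite /task_seg_wcet eqxx c_le ltW.
- by move=> _ j hj; rewrite lexx susp_ge0.
- move=> t s; case: ifP => // /andP[t0 tc] [<-]; split.
  + by rewrite ntasks_gt0 leqnn.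
  + by rewrite /task_nsegs eqxx.
  + by rewrite /= mul0r lee_fin.
  + by rewrite /= eqxx (le_lt_trans (service_le _ mx _ _ t0)).
- move=> t i k j [hi hj rt] /=; case: eqP => [|_]; last first.
    by rewrite ltNge service_ge0.
  move=> [? ? ?]; subst i k j; move: rt; rewrite /= mul0r lee_fin => t0 sc.
  exists (ntasks ts), 0%N, 1%N; split => //; rewrite t0 /=.
  case: (ltP t c) => // ct; move: sc; rewrite ltNge => /negP[].
  apply: le_trans (service_mono _ mx _ _ _ (ltW c_gt0) ct).
  rewrite serviceE (work_full _ mx _ _ _ (ltW c_gt0)) ?subr0 // => u /andP[u0 uc].
  by exists seg => //=; rewrite (ltW u0) uc.
Qed.

Lemma wcrt_ge : (c%:E <= wcrt ts)%E.
Proof.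
apply: le_trans (ereal_sup_ubound _); last first.
  by exists x, 0%N; split; [exact: single_job_legal|reflexivity].
have f1 : (c%:E <= finish_time x (ntasks ts) 0 1)%E.
  apply: le_ereal_inf_tmp => _ [t [/= t0 ct] <-]; rewrite lee_fin.
  move: t0 ct; rewrite mul0r lee_fin eqxx => t0 ct.
  exact: le_trans ct (service_le _ mx _ _ t0).
rewrite /response_time /= mul0r sube0; apply: (le_trans f1).
move: nsegs_gt0; rewrite leq_eqVlt => /orP[/eqP <- //|m1].
apply: le_trans (finish_from_ge _ _ _).
apply: (finish_le_ready _ _ single_job_legal) => //.
  by rewrite ntasks_gt0 leqnn.
by rewrite /task_nsegs eqxx.
Qed.

End SingleJob.

(** * Blocks of the joint and split methods *)

Lemma exists_block {R : realType} (ts : taskset R) (J : nat -> bool) (j : nat) :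
  (1 <= j <= nsegs ts)%N ->
  exists a b, [/\ (1 <= a <= j)%N, (j <= b <= nsegs ts)%N & is_block ts J a b].
Proof.
case/andP=> j1 jm.
(* Go left from [j] to the nearest split interval or to segment 1; [b] is found likewise to the
   right. *)
have [a [a1 aj Ja allJa]] : exists a, [/\ (1 <= a)%N, (a <= j)%N,
    (a == 1%N) || ~~ J a.-1 & all J (index_iota a j)].
  elim: j j1 {jm} => // j IH _; have [->|j0] := posnP j; first by exists 1%N.
  case Jj: (J j); last by exists j.+1; rewrite /= Jj orbT /index_iota subnn.
  have [a [a1 aj Ja allJa]] := IH j0; exists a; split => //; first exact: leqW.
  apply/allP => i; rewrite mem_index_iota ltnS => /andP[ai].
  rewrite leq_eqVlt => /orP[/eqP -> //|ij].
  by apply: (allP allJa); rewrite mem_index_iota ai.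
have [b [jb bm Jb allJb]] : exists b, [/\ (j <= b)%N, (b <= nsegs ts)%N,
    (b == nsegs ts) || ~~ J b & all J (index_iota j b)].
  have [d dE] : exists d, (d = nsegs ts - j)%N by eexists.
  elim: d j jm dE {j1 a a1 aj Ja allJa} => [|d IH] j jm dE.
    exists j; rewrite /index_iota subnn leqnn; split => //.
    by rewrite eqn_leq jm -subn_eq0 -dE.
  have jm' : (j < nsegs ts)%N by rewrite -subn_gt0 -dE.
  case Jj: (J j); last by exists j; rewrite Jj orbT /index_iota subnn leqnn.
  have [|b [jb bm Jb allJb]] := IH _ jm'; first by rewrite subnS -dE.
  exists b; split => //; first exact: ltnW.
  apply/allP => i; rewrite mem_index_iota leq_eqVlt => /andP[/orP[/eqP <- //|ji] ib].
  by apply: (allP allJb); rewrite mem_index_iota ji.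
exists a, b; rewrite a1 aj jb bm; split => //; rewrite /is_block Ja Jb /=.
apply/allP => i; rewrite mem_index_iota => /andP[ai ib].
case: (ltnP i j) => ij; [apply: (allP allJa)|apply: (allP allJb)];
  by rewrite mem_index_iota ?ai ?ij.
Qed.

(* Each segment, and each joint interval, lies in some block. *)
Lemma sum_blocks_ge {R : realType} (ts : taskset R) (J : nat -> bool) (f g : nat -> R) :
  (forall j, 0 <= f j) -> (forall j, 0 <= g j) ->
  \sum_(1 <= j < (nsegs ts).+1) f j + \sum_(1 <= j < nsegs ts | J j) g j <=
  \sum_(1 <= a < (nsegs ts).+1) \sum_(a <= b < (nsegs ts).+1 | is_block ts J a b)
    (\sum_(a <= j < b.+1) f j + \sum_(a <= j < b) g j).
Proof.
move=> f0 g0; set n := nsegs ts.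
(* [h a b j] is what index [j] contributes to the block from [a] to [b]. After exchanging the sums,
   one block containing [j] suffices for each [j]. *)
pose h a b j : R := (if (a <= j <= b)%N then f j else 0) + (if (a <= j < b)%N then g j else 0).
have h0 a b j : 0 <= h a b j by rewrite addr_ge0 //; case: ifP.
have sub_range (p q : nat) (F : nat -> R) : (1 <= p)%N -> (q <= n.+1)%N ->
    \sum_(p <= j < q) F j = \sum_(1 <= j < n.+1) (if (p <= j < q)%N then F j else 0).
  move=> p1 qn; rewrite -big_mkcond /=.
  rewrite (big_nat_widen _ _ _ _ _ qn) (big_nat_widenl _ _ _ _ _ p1) /=.
  by apply: eq_bigl => j; rewrite andbC.
have -> : \sum_(1 <= a < n.+1) \sum_(a <= b < n.+1 | is_block ts J a b)
      (\sum_(a <= j < b.+1) f j + \sum_(a <= j < b) g j) =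
    \sum_(1 <= j < n.+1) \sum_(1 <= a < n.+1) \sum_(a <= b < n.+1 | is_block ts J a b) h a b j.
  rewrite [RHS]exchange_big; apply: eq_big_nat => a /andP[a1 an].
  rewrite [RHS]exchange_big [LHS]big_nat_cond [RHS]big_nat_cond.
  apply: eq_bigr => b /andP[/andP[ab bn] _].
  rewrite (sub_range a b.+1 f a1) // (sub_range a b g a1) ?(ltnW bn) // -big_split /=.
  by apply: eq_bigr => j _; rewrite /h ltnS.
have -> : \sum_(1 <= j < n | J j) g j = \sum_(1 <= j < n.+1) (if (j < n)%N && J j then g j else 0).
  rewrite -big_mkcond /= (big_nat_widen _ _ _ _ _ (leqnSn n)) /=.
  by apply: eq_bigl => j; rewrite andbC.
rewrite -big_split /=; apply: ler_sum_nat => j hj.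
have [a [b [/andP[a1 aj] /andP[jb bn] blk]]] := exists_block ts J j hj.
rewrite (bigD1_seq a) ?iota_uniq //=; last by rewrite mem_index_iota a1 (leq_ltn_trans aj) //; case/andP: hj.
apply: ler_wpDr; first by apply: sumr_ge0 => a' _; apply: sumr_ge0.
rewrite big_mkcond (bigD1_seq b) ?iota_uniq //=; last by rewrite mem_index_iota (leq_trans aj jb) ltnS.
apply: ler_wpDr; first by apply: sumr_ge0 => b' _; case: ifP.
rewrite blk /h aj jb /= lerD2l; case: ifP => [/andP[jn Jj]|_]; last by case: ifP.
(* A block ends only at a split interval or at the last segment, so the joint interval [j] lies
   inside it. *)
suff -> : (j < b)%N by [].
rewrite ltn_neqAle jb andbT; apply/eqP => jE; subst b.
by case/and3P: blk => _; rewrite Jj orbF => /eqP jn'; rewrite jn' ltnn in jn.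
Qed.

(** * Lower bounds on [UB_seg] and [UB_ss], and the feasible point of the MILP *)

Section Milp.
Context {R : realType} (m : nat) (eps Tn : R).
Hypotheses (m_ge2 : (2 <= m)%N) (eps_gt0 : 0 < eps) (eps_lt : m%:R * eps < 1).

Local Notation ts := (T_MILP m m eps Tn).
Local Notation M := (m%:R : R).
Local Notation Tlow := (16 * M * M ^+ 2 + (M - 1) * (2 * M - 1)).
Local Notation Rj := (8 * M ^+ 2 + 6 * M + 1 + M * eps).
Local Notation S := (2 * M - 1).

Lemma milp_bounds : [/\ 2 <= M, 0 < eps, M * eps < 1, 2 * eps < 1 & 32 * M <= 16 * M * M ^+ 2].
Proof.
have M2 : 2 <= M by rewrite ler_nat.
have m1 : 2 * eps <= M * eps by rewrite ler_pM2r.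
split => //; first exact: le_lt_trans m1 eps_lt.
rewrite [leLHS]mulrC -mulrA [leRHS](_ : _ = M * (16 * M ^+ 2)); last by ring.
rewrite ler_wpM2l // expr2; have : 2 * 2 <= M * M by rewrite ler_pM.
lra.
Qed.

Lemma wcet_low : [/\ wcet ts 1 = 1, wcet ts 2 = M & wcet ts 3 = 2 * M - 1 + eps].
Proof. by []. Qed.

Lemma low_task_ceil (t : R) (c : R) : 0 < c -> t <= c * (Num.ceil (t / c))%:~R.
Proof. by move=> c0; rewrite mulrC -ler_pdivrMr // ceil_ge. Qed.

Lemma ceil_ge_nat (t : R) (n : nat) : n%:R < t -> (n.+1)%:R <= (Num.ceil t)%:~R :> R.
Proof.
move=> nt; have : (n%:Z < Num.ceil t) by rewrite ceil_gt_int.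
by rewrite -lezD1 -(ler_int R) -natr1 intrD.
Qed.

(** At a fixed point [t < B], task 1 demands at least t/2, tasks 2 and 3 are counted through the
    window of length 8m containing [t], and every other task has at least one job. As the capacity
    (K + 1)(1 - eps) left free is at most the remaining workload, the equation pushes [t] out of its
    window. *)
Lemma rho_ge_of (W B : R) :
  (forall K : nat, 8 * M * K%:R < B -> (K%:R + 1) * (1 - eps) <= W + M * (1 - eps)) ->
  (B%:E <= rho ts W)%E.
Proof.
have [M2 e0 _ e1 M3] := milp_bounds; have [T1 T2 T3] := period_low m eps Tn; have [C1 C2 C3] := wcet_low.
move=> cap; apply: le_ereal_inf_tmp => _ [t [t0 fix_t] <-]; rewrite lee_fin leNgt.
apply/negP => tB; move: fix_t; rewrite -[ntasks ts]/(m + 4)%N sum_tasks T1 T2 T3 C1 C2 C3.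
(* The window of [t] is 8mK < t <= 8m(K + 1). *)
pose K := `|Num.ceil (t / (8 * M)) - 1|%N.
have t8 : 0 < t / (8 * M) by rewrite divr_gt0 //; lra.
have cK : Num.ceil (t / (8 * M)) = K%:Z + 1.
  by rewrite /K gez0_abs ?subrK // subr_ge0 -gtz0_ge1 ceil_gt0.
have /andP[] := ceil_itv (t / (8 * M)); rewrite cK addrK intrD.
rewrite ltr_pdivlMr ?ler_pdivrMr; [|lra|lra]; rewrite -!pmulrn (mulrC K%:R) => lK uK.
clearbody K; clear cK.
have high : M * (1 - eps) <=
    \sum_(4 <= i < m + 4) (Num.ceil (t / period ts i))%:~R * wcet ts i.
  rewrite mulr_natl -[X in _ *+ X](addnK 4 m) -sumr_const_nat.
  apply: ler_sum_nat => i hi; rewrite wcet_high; last by case/andP: hi.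
  rewrite ler_peMl; [by []|lra|]; rewrite period_high //.
  apply: (@ceil_ge_nat _ 0); rewrite divr_gt0 //.
  have : 0 <= (M - 1) * (2 * M - 1) by apply: mulr_ge0; lra.
  by move: M3; move: (16 * M * M ^+ 2) ((M - 1) * (2 * M - 1)) => A B'; lra.
have c2 := low_task_ceil t 2 (ltr0n R 2).
have c4 (n : nat) : 4 * M * n%:R < t -> (n%:R + 1) * M <= (Num.ceil (t / (4 * M)))%:~R * M.
  by move=> nt; rewrite ler_wpM2r // natr1 ceil_ge_nat // ltr_pdivlMr; lra.
have c4a := c4 (2 * K)%N; have c4b := c4 (2 * K + 1)%N.
rewrite natrM in c4a; rewrite natrD natrM in c4b; clear c4.
move: high; set hi := \sum_(_ <= _ < _) _ => high fix_t.
have capK := cap K (lt_trans lK tB).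
have := cap K.+1; rewrite -(natr1 K) => capK1.
have K0 : 0 <= K%:R :> R by [].
(* In the first half of the window task 2 has at least 2K + 1 jobs, which forces t >= 8mK + 6m; in
   the second half it has at least 2K + 2, which forces t >= 8m(K + 1). *)
case: (ltP t (8 * M * (K%:R + 1))) => tK.
  case: (lerP t (8 * M * K%:R + 4 * M)) => t4.
    by have := c4a _; lra.
  by have := c4b _; lra.
(* At t = 8m(K + 1), the hypothesis for the next window, which starts at [t < B], gives the missing
   strictness. *)
by have := c4b _; have := capK1 (le_lt_trans tK tB); lra.
Qed.

(** At the smallest such [K] the difference is 8m(m - 1)(k - 1) + 2m - 1 - k m eps, nonnegative
    since m eps < 1. *)
Lemma window_count_lt (k K : R) : 1 <= k -> 2 * M * k + 1 <= K + M ->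
  k * Rj + (k - 1) * S <= 8 * M * K.
Proof.
have [M2 e0 Me1 e1 _] := milp_bounds => k1 kK.
have : k * (M * eps) <= k by rewrite ler_piMr; lra.
have : 8 * M * (2 * M * k + 1) <= 8 * M * (K + M) by rewrite ler_wpM2l //; lra.
have : 0 <= (k - 1) * (M - 2) * M by rewrite !mulr_ge0; lra.
have : 0 <= (k - 1) * (M - 2) by rewrite !mulr_ge0; lra.
lra.
Qed.

(** In units of 1 - eps, the block and the m other tasks amount to at least k + m + (k - 1)(2m - 1)
    = 2mk - m + 1. By [window_count_lt], no more windows than that start before the claimed
    bound. *)
Lemma block_rho_ge (k : nat) : (1 <= k)%N ->
  ((k%:R * Rj + (k%:R - 1) * S)%:E <= rho ts (k%:R * (1 - eps) + (k%:R - 1) * S))%E.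
Proof.
move=> k1; have [M2 e0 Me1 e1 _] := milp_bounds; apply: rho_ge_of => K KB.
have kR : 1 <= k%:R :> R by rewrite ler1n.
have nE : (k + m + k.-1 * (2 * m).-1)%:R = k%:R + M + (k%:R - 1) * S.
  by rewrite !natrD natrM -!subn1 !natrB ?natrM // muln_gt0 (ltnW m_ge2).
have Kk : K%:R + 1 <= k%:R + M + (k%:R - 1) * S.
  rewrite -nE natr1 ler_nat ltnNge; apply/negP.
  rewrite -(ler_nat R) nE => kK; move: KB; rewrite ltNge => /negP; apply.
  by apply: window_count_lt => //; lra.
have y0 : 0 <= (k%:R - 1) * S by apply: mulr_ge0; lra.
have ys : (k%:R - 1) * S * (1 - eps) <= (k%:R - 1) * S by rewrite ler_piMr; lra.
have s0 : 0 <= 1 - eps by lra.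
by have := ler_wpM2r s0 Kk; lra.
Qed.

Lemma UB_seg_ge (j : nat) : (Rj%:E <= UB_seg ts j)%E.
Proof. by have := block_rho_ge 1 isT; rewrite !mul1r subrr mul0r !addr0. Qed.

Lemma block_rho_geE (a b : nat) : (a <= b)%N ->
  ((\sum_(a <= j < b.+1) Rj + \sum_(a <= j < b) S)%:E <= rho ts (block_workload ts a b))%E.
Proof.
move=> ab; rewrite /block_workload /= !sumr_const_nat.
have k1 : (1 <= b.+1 - a)%N by rewrite subn_gt0 ltnS.
have := block_rho_ge (b.+1 - a) k1.
have -> : (b.+1 - a)%:R - 1 = (b - a)%:R :> R by rewrite subSn // -natr1 addrK.
by rewrite !mulr_natl.
Qed.

(** Split intervals occur on both sides and cancel; the segments and joint intervals are covered by
    blocks, bounded through [block_rho_geE]. *)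
Lemma UB_ss_ge : ((total_susp ts + \sum_(1 <= j < m.+1) Rj)%:E <= UB_ss ts)%E.
Proof.
have [M2 e0 Me1 e1 _] := milp_bounds.
apply: le_ereal_inf_tmp => _ [J _ <-]; rewrite /joint_split_bound.
have Rj0 : 0 <= Rj by have := sqr_ge0 M; have := mulr_ge0 (ler0n R m) (ltW e0); lra.
have S0 : 0 <= S by lra.
have := sum_blocks_ge ts J (fun=> Rj) (fun=> S) (fun=> Rj0) (fun=> S0).
rewrite -lee_fin => blocks.
rewrite /total_susp [X in X + _](bigID J) addrAC EFinD leeD2r //.
rewrite addrC; apply: (le_trans blocks).
rewrite -sumEFin; apply: lee_sum => a _; rewrite -sumEFin.
rewrite big_nat_cond [leRHS]big_nat_cond.
by apply: lee_sum => b /andP[/andP[ab _] _]; exact: block_rho_geE.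
Qed.

(** With offset 0, [milp_rel] of task 3 would be 8m^2, exactly two periods of task 2 before the end
    of its jobs, and [milp_busy] would fail. Offset 1 leaves room for only one job of task 2. *)
Definition milp_witness : @milp_point R := {|
  mR := fun=> Rj;
  mO := fun i _ => if i == 3%N then 1 else 0;
  mN := fun i _ => match i with
    | 1%N => (4 * m ^ 2 + 3 * m + 1)%N
    | 2%N => (2 * m + 2)%N
    | 3%N => (m + 1)%N
    | _ => 0%N
    end
|}.

Local Notation p := milp_witness.

Lemma witness_counts (j : nat) : [/\ (mN p 1 j)%:~R = 4 * M ^+ 2 + 3 * M + 1 :> R,
  (mN p 2 j)%:~R = 2 * M + 2 :> R & (mN p 3 j)%:~R = M + 1 :> R].
Proof. by split; rewrite /= -pmulrn !(natrD, natrM, natrX). Qed.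

Lemma witness_high (i j : nat) : (4 <= i)%N -> mN p i j = 0 /\ mO p i j = 0.
Proof. by case: i => [|[|[|[|]]]]. Qed.

Lemma high_period_gt (i : nat) : (4 <= i < m + 4)%N -> 16 * M * M ^+ 2 <= period ts i.
Proof.
have [M2 _ _ _ _] := milp_bounds => hi; rewrite period_high // lerDl; apply: mulr_ge0; lra.
Qed.

Lemma task_cases (P : nat -> Prop) : P 1%N -> P 2%N -> P 3%N ->
  (forall i, (4 <= i < m + 4)%N -> P i) -> forall i, (1 <= i < ntasks ts)%N -> P i.
Proof.
move=> P1 P2 P3 P4 i; case: (ltnP i 4) => i4 /andP[i1 im].
  by case: i i4 i1 im => [|[|[|[|]]]].
by apply: P4; rewrite i4.
Qed.

(** The jobs of tasks 1, 2, 3 span 8m^2 + 6m + 2, 8m^2 + 8m and 8m^2 + 8m, all less than R_j + S =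
    8m^2 + 8m + m eps, so every segment can reuse the same offsets. *)
Lemma witness_next (i j : nat) : (1 <= i < ntasks ts)%N ->
  mO p i j + (mN p i j)%:~R * period ts i - (Rj + S) <= mO p i j.+1.
Proof.
have [M2 e0 Me1 e1 _] := milp_bounds; have [T1 T2 T3] := period_low m eps Tn.
have [N1 N2 N3] := witness_counts j; have sq := sqr_ge0 M; have Me0 := mulr_ge0 (ler0n R m) (ltW e0).
move: i; apply: task_cases.
- by rewrite N1 T1 /=; lra.
- by rewrite N2 T2 /=; lra.
- by rewrite N3 T3 /=; lra.
move=> i /andP[i4 _]; have [-> ->] := witness_high i j i4.
by have [_ ->] := witness_high i j.+1 i4; lra.
Qed.

Lemma le_ceil_of (z : int) (t : R) : z%:~R - 1 < t -> z <= Num.ceil t.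
Proof. by move=> zt; rewrite -ltzD1 -ltrBlDr ceil_gt_int intrB. Qed.

Lemma witness_N (i j : nat) : (1 <= i < ntasks ts)%N ->
  0 <= mN p i j <= Num.ceil ((Rj - mO p i j) / period ts i).
Proof.
have [M2 e0 Me1 e1 _] := milp_bounds; have [T1 T2 T3] := period_low m eps Tn.
have [N1 N2 N3] := witness_counts j; have sq := sqr_ge0 M.
have Me0 := mulr_gt0 (lt_le_trans (ltr0n R 2) M2) e0.
move=> hi; apply/andP; split; first by case: i {hi} => [|[|[|[|]]]].
apply: le_ceil_of; move: i hi; apply: task_cases.
- by rewrite N1 T1 ltr_pdivlMr /=; lra.
- by rewrite N2 T2 ltr_pdivlMr /=; lra.
- by rewrite N3 T3 ltr_pdivlMr /=; lra.
move=> i hi; have /andP[i4 _] := hi; have [-> ->] := witness_high i j i4.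
have T0 : 0 < period ts i by apply: lt_le_trans (high_period_gt i hi); rewrite !mulr_gt0 ?exprn_gt0 //; lra.
by apply: lt_le_trans (_ : 0 <= _); [lra|rewrite divr_ge0 ?(ltW T0) //; lra].
Qed.

Lemma witness_R (j : nat) :
  Rj = seg_wcet ts j + \sum_(1 <= i < ntasks ts) (mN p i j)%:~R * wcet ts i.
Proof.
have [N1 N2 N3] := witness_counts j; have [C1 C2 C3] := wcet_low.
rewrite -[ntasks ts]/(m + 4)%N sum_tasks N1 N2 N3 C1 C2 C3 big_nat big1 => [/=|i /andP[i4 _]].
  by ring.
by have [-> _] := witness_high i j i4; rewrite mul0r.
Qed.

Lemma busy_term_le (y C : R) (n : int) : 0 <= C -> 0 <= n -> y < n%:~R + 1 ->
  Num.max 0 ((Num.floor y)%:~R * C) <= n%:~R * C.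
Proof.
move=> C0 n0 yn; rewrite ge_max mulr_ge0 ?ler0z //= ler_wpM2r // ler_int.
by rewrite -ltzD1 floor_lt_int intrD.
Qed.

Lemma busy_term_le_id (y C : R) : 0 <= C -> 0 <= y ->
  Num.max 0 ((Num.floor y)%:~R * C) <= y * C.
Proof. by move=> C0 y0; rewrite ge_max mulr_ge0 //= ler_wpM2r // floor_le. Qed.

Local Notation busy i j := (milp_rel ts p i j
  + \sum_(1 <= l < ntasks ts)
      Num.max 0
        ((Num.floor ((mO p l j + (mN p l j)%:~R * period ts l
                      - milp_rel ts p i j) / period ts l))%:~R * wcet ts l)).

(** [n1], [n2], [n3] bound the floors for tasks 1, 2, 3. The other tasks have no job and offset 0,
    so their floors are at most 0. *)
Lemma witness_busy_low (i j : nat) (n1 n2 n3 : nat) : 0 <= milp_rel ts p i j ->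
  2 * (4 * M ^+ 2 + 3 * M + 1) - milp_rel ts p i j < 2 * (n1%:R + 1) ->
  4 * M * (2 * M + 2) - milp_rel ts p i j < 4 * M * (n2%:R + 1) ->
  1 + 8 * M * (M + 1) - milp_rel ts p i j < 8 * M * (n3%:R + 1) ->
  busy i j <= milp_rel ts p i j + n1%:R + n2%:R * M + n3%:R * (2 * M - 1 + eps).
Proof.
have [M2 e0 Me1 e1 _] := milp_bounds; have [T1 T2 T3] := period_low m eps Tn.
have [N1 N2 N3] := witness_counts j; have [C1 C2 C3] := wcet_low.
move: (milp_rel ts p i j) => rel rel0 h1 h2 h3.
rewrite -[ntasks ts]/(m + 4)%N sum_tasks N1 N2 N3 C1 C2 C3 T1 T2 T3.
rewrite -!addrA lerD2l; apply: lerD; last apply: lerD; last rewrite -[leRHS]addr0; last apply: lerD.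
- rewrite -[leRHS]mulr1; apply: (@busy_term_le _ _ n1%:Z) => //=.
  by rewrite ltr_pdivrMr //; lra.
- apply: (@busy_term_le _ _ n2%:Z) => //=.
  by rewrite ltr_pdivrMr; lra.
- apply: (@busy_term_le _ _ n3%:Z) => //=; first by lra.
  by rewrite ltr_pdivrMr; lra.
rewrite big_nat big1 // => l hl; have /andP[l4 _] := hl.
have [-> ->] := witness_high l j l4.
have T0 : 0 < period ts l by apply: lt_le_trans (high_period_gt l hl); rewrite !mulr_gt0 ?exprn_gt0 //; lra.
apply/eqP; rewrite eq_le le_max lexx andbT -[leRHS](mul0r (wcet ts l)).
apply: (@busy_term_le _ _ 0) => //; first by rewrite wcet_high //; lra.
by rewrite ltr_pdivrMr // !mulr0z mul0r !add0r mul1r; lra.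
Qed.

(** Without jobs, [milp_rel] is minus the period T, and the floors count an extra stretch T. Tasks
    1, 2, 3 leave 1 - eps of it free per 8m, which outweighs the m other tasks, each counted
    once. *)
Lemma witness_busy_high (i j : nat) : (4 <= i < m + 4)%N -> busy i j < Rj.
Proof.
have [M2 e0 Me1 e1 M3] := milp_bounds; have [T1 T2 T3] := period_low m eps Tn.
have [N1 N2 N3] := witness_counts j; have [C1 C2 C3] := wcet_low.
move=> hi; have /andP[i4 _] := hi; have TM := high_period_gt i hi.
have Ti := period_high m eps Tn i hi.
have -> : milp_rel ts p i j = - period ts i.
  by rewrite /milp_rel; have [-> ->] := witness_high i j i4; rewrite sub0r add0r mulrN1z mulN1r.
rewrite Ti in TM *; move: Tlow Ti TM => T Ti TM.
have MM : 2 * M ^+ 2 <= M * M ^+ 2 by rewrite ler_wpM2r // sqr_ge0.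
have M2gt0 : 0 < M ^+ 2 by rewrite exprn_gt0 //; lra.
have T0 : 0 < T by lra.
have Me0 := mulr_gt0 (lt_le_trans (ltr0n R 2) M2) e0.
pose X := (1 + T) / (8 * M).
have XE : 8 * M * X = 1 + T by rewrite /X mulrC divfK //; apply: lt0r_neq0; lra.
have X4 : 4 * M <= X by rewrite ler_pdivlMr; lra.
rewrite -[ntasks ts]/(m + 4)%N sum_tasks N1 N2 N3 C1 C2 C3 T1 T2 T3.
have sq := sqr_ge0 M; have MT := mulr_ge0 (ler0n R m) (ltW T0).
have b1 := @busy_term_le_id ((0 + (4 * M ^+ 2 + 3 * M + 1) * 2 - - T) / 2) 1 ler01.
have b2 := @busy_term_le_id ((0 + (2 * M + 2) * (4 * M) - - T) / (4 * M)) M (ler0n R m).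
have C30 : 0 <= 2 * M - 1 + eps by lra.
have b3 := @busy_term_le_id ((1 + (M + 1) * (8 * M) - - T) / (8 * M)) _ C30.
have b4 : \sum_(4 <= l < m + 4) Num.max 0
    ((Num.floor ((mO p l j + (mN p l j)%:~R * period ts l - - T) / period ts l))%:~R
     * wcet ts l) <= M * (1 - eps).
  rewrite mulr_natl -[X in _ *+ X](addnK 4 m) -sumr_const_nat.
  apply: ler_sum_nat => l hl; have /andP[l4 _] := hl.
  rewrite wcet_high // -[leRHS]mul1r; apply: (@busy_term_le _ _ 1) => //; first by lra.
  have [-> ->] := witness_high l j l4.
  rewrite (period_high m eps Tn l hl) -(period_high m eps Tn i hi) Ti.
  by rewrite mulr0z mul0r addr0 opprK add0r divff ?gt_eqF //; lra.
have y1 : (0 + (4 * M ^+ 2 + 3 * M + 1) * 2 - - T) / 2 = 4 * M ^+ 2 + 3 * M + 1 + T / 2.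
  by field.
have y2 : (0 + (2 * M + 2) * (4 * M) - - T) / (4 * M) * M = (2 * M + 2) * M + T / 4.
  by field; apply: lt0r_neq0; lra.
have y3 : (1 + (M + 1) * (8 * M) - - T) / (8 * M) = M + 1 + X.
  by rewrite /X; field; apply: lt0r_neq0; lra.
have {}b1 : Num.max 0 ((Num.floor ((0 + (4 * M ^+ 2 + 3 * M + 1) * 2 - - T) / 2))%:~R * 1)
    <= 4 * M ^+ 2 + 3 * M + 1 + T / 2.
  by apply: le_trans (b1 _) _; rewrite y1 ?mulr1 //; lra.
have {}b2 : Num.max 0 ((Num.floor ((0 + (2 * M + 2) * (4 * M) - - T) / (4 * M)))%:~R * M)
    <= (2 * M + 2) * M + T / 4.
  by apply: le_trans (b2 _) _; rewrite ?y2 // divr_ge0; lra.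
have {}b3 : Num.max 0 ((Num.floor ((1 + (M + 1) * (8 * M) - - T) / (8 * M)))%:~R
    * (2 * M - 1 + eps)) <= (M + 1 + X) * (2 * M - 1 + eps).
  by rewrite -y3; apply: b3; rewrite y3; lra.
apply: le_lt_trans (lerD (lexx _) (lerD (lerD (lerD b1 b2) b3) b4)) _.
have : (X - (M - 1)) * (1 / 2) <= (X - (M - 1)) * (1 - eps) by rewrite ler_wpM2l //; lra.
lra.
Qed.

Lemma witness_feasible : milp_feasible ts p.
Proof.
have [M2 e0 Me1 e1 _] := milp_bounds; have sq := sqr_ge0 M.
have Me0 := mulr_gt0 (lt_le_trans (ltr0n R 2) M2) e0.
split.
- by move=> j _; exact: witness_R.
- by move=> i j _ _ /=; case: ifP.
- by move=> i j hi _; exact: witness_next.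
- by move=> i j hi _; exact: witness_N.
- by move=> j _; exact: UB_seg_ge.
- exact: UB_ss_ge.
move=> i j hi _; have [N1 N2 N3] := witness_counts j.
have [T1 T2 T3] := period_low m eps Tn.
have relE l : milp_rel ts p l j = mO p l j + ((mN p l j)%:~R - 1) * period ts l.
  by rewrite /milp_rel intrB.
have [r1 r2 r3] : [/\ milp_rel ts p 1 j = 8 * M ^+ 2 + 6 * M,
    milp_rel ts p 2 j = 8 * M ^+ 2 + 4 * M & milp_rel ts p 3 j = 1 + 8 * M ^+ 2].
  by split; rewrite relE ?N1 ?N2 ?N3 ?T1 ?T2 ?T3 /=; ring.
move: i hi; apply: task_cases.
- apply: le_lt_trans (witness_busy_low 1 j 1 0 0 _ _ _ _) _; rewrite r1 /=; lra.
- apply: le_lt_trans (witness_busy_low 2 j (m + 1) 1 0 _ _ _ _) _; rewrite r2 ?natrD /=; lra.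
- apply: le_lt_trans (witness_busy_low 3 j (3 * m) 1 1 _ _ _ _) _; rewrite r3 ?natrM /=; lra.
by move=> i hi; exact: witness_busy_high.
Qed.

(** 8m(m + 1) is a fixed point: its m + 1 windows leave (m + 1)(1 - eps), exactly the segment and
    one job of each of the m other tasks. This makes the optimum finite. *)
Lemma rho_seg_le (j : nat) : (UB_seg ts j <= (8 * M * (M + 1))%:E)%E.
Proof.
have [M2 e0 Me1 e1 M3] := milp_bounds; have [T1 T2 T3] := period_low m eps Tn.
have [C1 C2 C3] := wcet_low.
have t0 : 0 < 8 * M * (M + 1) by rewrite !mulr_gt0; lra.
apply: ereal_inf_lbound; exists (8 * M * (M + 1)); last by [].
split; first by [].
rewrite -[ntasks ts]/(m + 4)%N sum_tasks T1 T2 T3 C1 C2 C3.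
have ceilE (n : nat) (t : R) : t = n%:R -> (Num.ceil t)%:~R = n%:R :> R.
  by move=> ->; rewrite (intrKceil n%:Z).
have M0 : M != 0 by apply: lt0r_neq0; lra.
rewrite (ceilE (4 * m * m.+1)%N (_ / 2)); last by rewrite !natrM -(natr1 m); field.
rewrite (ceilE (2 * m.+1)%N (_ / (4 * M))); last by rewrite natrM -(natr1 m); field.
rewrite (ceilE m.+1 (_ / (8 * M))); last by rewrite -(natr1 m); field.
have -> : \sum_(4 <= i < m + 4) (Num.ceil (8 * M * (M + 1) / period ts i))%:~R * wcet ts i
    = M * (1 - eps).
  apply: (@etrans _ _ (\sum_(4 <= i < m + 4) (1 - eps))); last by rewrite sumr_const_nat addnK mulr_natl.
  apply: eq_big_nat => i hi; have /andP[i4 _] := hi; rewrite wcet_high //.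
  have TM := high_period_gt i hi.
  have MM : 2 * M ^+ 2 <= M * M ^+ 2 by rewrite ler_wpM2r // sqr_ge0.
  have M1 : 2 * M <= M ^+ 2 by rewrite expr2 ler_wpM2r //; lra.
  rewrite (@ceil_def _ _ 1) ?mul1r // subrr divr_gt0 //; last by lra.
  by rewrite ler_pdivrMr; lra.
by rewrite /= !natrM -(natr1 m); ring.
Qed.

Lemma milp_opt_bounds : exists opt : R, milp_opt ts = opt%:E /\
  m%:R * Rj + (M - 1) * S <= opt.
Proof.
have [M2 e0 Me1 e1 _] := milp_bounds.
have lower : ((m%:R * Rj + (M - 1) * S)%:E <= milp_opt ts)%E.
  apply: ereal_sup_ubound; exists p; first exact: witness_feasible.
  rewrite /milp_objective /total_susp /= !sumr_const_nat subSS subn0; congr (_%:E).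
  by rewrite -(mulr_natl Rj) -(mulr_natl S) natrB ?(ltnW m_ge2) // addrC.
have upper : (milp_opt ts <= (total_susp ts + \sum_(1 <= j < m.+1) 8 * M * (M + 1))%:E)%E.
  apply: ge_ereal_sup => _ [p' fp' <-]; rewrite lee_fin lerD2l.
  apply: ler_sum_nat => j hj; rewrite -lee_fin.
  by apply: le_trans (milp_UB_seg fp' hj) (rho_seg_le j).
exists (fine (milp_opt ts)); have fin : milp_opt ts \is a fin_num.
  by move: lower upper; case: (milp_opt ts).
by rewrite fineK //; split => //; rewrite -lee_fin fineK.
Qed.

End Milp.

(** * Combination of the two sides *)

Theorem theorem4 (R : realType) (m q : nat) (eps : R) :
  (2 <= m)%N -> q = m -> 0 < eps < 1 / q%:R ->
  exists T0 : R, forall Tn : R, T0 <= Tn ->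
  exists opt w : R,
    [/\ milp_opt (T_MILP q m eps Tn) = opt%:E,
        wcrt (T_MILP q m eps Tn) = w%:E,
        0 < w,
        opt / w >=
          (m%:R * (8 * m%:R ^+ 2 + 6 * m%:R + 1 + m%:R * eps)
             + (m%:R - 1) * (2 * m%:R - 1))
          / (16 * m%:R ^+ 2 + (m%:R - 1) * (2 * m%:R - 1))
      & (m%:R * (8 * m%:R ^+ 2 + 6 * m%:R + 1 + m%:R * eps)
             + (m%:R - 1) * (2 * m%:R - 1))
          / (16 * m%:R ^+ 2 + (m%:R - 1) * (2 * m%:R - 1))
        >= (4 * m%:R + 4) / 9].
Proof.
move=> m_ge2 -> {q} /andP[eps_gt0 eps_lt].
have m_gt0 : 0 < m%:R :> R by rewrite ltr0n ltnW.
have Meps : m%:R * eps < 1 by rewrite mulrC -ltr_pdivlMr.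
have [M2 _ _ e1 _] := milp_bounds m eps m_ge2 eps_gt0 Meps.
have eps_lt1 : eps < 1 by lra.
(* A period of at least [resp_bound m] keeps the jobs of the suspending task from overlapping. *)
exists (resp_bound m) => Tn Tn_ge.
have [opt [optE opt_ge]] := milp_opt_bounds m eps Tn m_ge2 eps_gt0 Meps.
have w_ge : ((1 - eps)%:E <= wcrt (T_MILP m m eps Tn))%E.
  apply: wcrt_ge => //=.
  - by rewrite addn4.
  - exact: ltnW.
  - by lra.
  - move=> i j hi _; rewrite /task_seg_wcet /=; case: eqP => _; first by lra.
    by case: i hi => [|[|[|[|i]]]] //= _; lra.
  - by move=> j _; lra.
have w_le : (wcrt (T_MILP m m eps Tn) <= (resp_bound m)%:E)%E.
  apply: ge_ereal_sup => _ [x [k [lx ->]]].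
  exact: (response_time_le m eps Tn m_ge2 eps_gt0 eps_lt1 Tn_ge x lx k).
have w_fin : wcrt (T_MILP m m eps Tn) \is a fin_num.
  by move: w_ge w_le; case: (wcrt _).
exists opt, (fine (wcrt (T_MILP m m eps Tn))); rewrite fineK //.
rewrite -(fineK w_fin) !lee_fin /resp_bound in w_ge w_le.
have w_gt0 : 0 < fine (wcrt (T_MILP m m eps Tn)) by lra.
have sq := sqr_ge0 (m%:R : R); have Me0 := mulr_gt0 m_gt0 eps_gt0.
have S0 : 0 <= (m%:R - 1) * (2 * m%:R - 1) :> R by apply: mulr_ge0; lra.
have L0 : 0 < 16 * m%:R ^+ 2 + (m%:R - 1) * (2 * m%:R - 1) :> R by lra.
split=> //.
- apply: ler_pM => //; last by rewrite lef_pV2.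
    by apply: addr_ge0 => //; apply: mulr_ge0; lra.
  by rewrite invr_ge0 ltW.
(* After clearing denominators the cubic terms cancel, and the difference is 12m^2 - 10m + 5 + 9m^2
   eps. *)
rewrite ler_pdivlMr // mulrAC ler_pdivrMr //.
have MMe : 0 <= m%:R * (m%:R * eps) by rewrite mulr_ge0 // ltW.
have M2M : 2 * m%:R <= m%:R ^+ 2 :> R by rewrite expr2 ler_wpM2r // ltW.
lra.
Qed.
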